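(* Let $\lambda$ be an infinite cardinal. If there exists an infinite cardinal $\mu$ such that $\mu^{++} \leq \lambda$, i.e. if $\lambda \geq \aleph_2$, then there is a regular ultrafilter $\mathcal{D}_*$ on $\lambda$ such that $\mathrm{lcf}(\aleph_0, \mathcal{D}_* ) \geq \lambda^+$ but $\mathcal{D}_*$ does not saturate the theory of the random graph.
   Context: A filter $\mathcal{D}$ on $\lambda$ is regular if there is a family $\langle X_i : i < \lambda\rangle$ of members of $\mathcal{D}$ such that each $t \in \lambda$ lies in only finitely many $X_i$. For an ultrafilter $\mathcal{D}$ on $\lambda$, $\mathrm{lcf}(\aleph_0, \mathcal{D})$ is the coinitiality of the set of elements of $(\omega, <)^\lambda/\mathcal{D}$ lying above the diagonal embedding of $\omega$ (i.e. the cofinality of this set under the reverse order). A regular ultrafilter $\mathcal{D}$ on $\lambda$ saturates a countable complete first-order theory $T$ if $M^\lambda/\mathcal{D}$ is $\lambda^+$-saturated for every $M \models T$ (for regular $\mathcal{D}$ this does not depend on the choice of $M \models T$). *)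

(* Defs.v *)
From mathcomp Require Export all_boot.
From mathcomp Require Export boolp classical_sets functions cardinality filter.

Set Implicit Arguments.
Unset Strict Implicit.
Unset Printing Implicit Defensive.

Local Open Scope classical_set_scope.
Local Open Scope card_scope.

(** * Cardinals

    A cardinal is given by a type having that cardinality. *)

Definition infinite_card (K : Type) : Prop := infinite_set [set: K].

Definition card_lt (T U : Type) (A : set T) (B : set U) : Prop :=
  A #<= B /\ ~ (B #<= A).

(* K' has cardinality |K|^+, the least cardinal above |K|. *)
Definition is_succ_card (K K' : Type) : Prop :=
  card_lt [set: K] [set: K'] /\
  forall X : Type, card_lt [set: K] [set: X] -> [set: K'] #<= [set: X].

(** * First-order logic *)

Record language : Type := Language {
  fun_symb : Type;
  fun_arity : fun_symb -> nat;
  rel_symb : Type;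
  rel_arity : rel_symb -> nat }.

Inductive term (L : language) : Type :=
| Var of nat
| App (f : fun_symb L) of ('I_(fun_arity f) -> term L).

Arguments Var {L} _.
Arguments App {L} _ _.

Inductive formula (L : language) : Type :=
| FBot
| FEq of term L & term L
| FRel (r : rel_symb L) of ('I_(rel_arity r) -> term L)
| FImp of formula L & formula L
| FAll of nat & formula L.

Arguments FBot {L}.
Arguments FEq {L} _ _.
Arguments FRel {L} _ _.
Arguments FImp {L} _ _.
Arguments FAll {L} _ _.

Section DerivedConnectives.
Variable L : language.
Implicit Types p q : formula L.

Definition FNot p := FImp p FBot.
Definition FTrue : formula L := FNot FBot.
Definition FAnd p q := FNot (FImp p (FNot q)).
Definition FEx (n : nat) p := FNot (FAll n (FNot p)).
Definition FConj (s : seq (formula L)) := foldr FAnd FTrue s.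
Definition FAlls (s : seq nat) p := foldr FAll p s.

End DerivedConnectives.

Arguments FTrue {L}.

(* [term_fv t n]: the variable n occurs in t; [fv p n]: it occurs free in p. *)
Fixpoint term_fv (L : language) (t : term L) : set nat :=
  match t with
  | Var k => [set k]
  | App _ ts => [set n | exists i, term_fv (ts i) n]
  end.

Fixpoint fv (L : language) (p : formula L) : set nat :=
  match p with
  | FBot => set0
  | FEq s t => term_fv s `|` term_fv t
  | FRel _ ts => [set n | exists i, term_fv (ts i) n]
  | FImp p q => fv p `|` fv q
  | FAll k p => fv p `\ k
  end.

Record structure (L : language) : Type := Structure {
  carrier :> Type;
  carrier_inh : inhabited carrier;
  fun_interp : forall f : fun_symb L, ('I_(fun_arity f) -> carrier) -> carrier;
  rel_interp : forall r : rel_symb L, ('I_(rel_arity r) -> carrier) -> Prop }.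

Arguments fun_interp {L} _ _ _.
Arguments rel_interp {L} _ _ _.

Definition update (T : Type) (v : nat -> T) (n : nat) (a : T) : nat -> T :=
  fun k => if k == n then a else v k.

Fixpoint eval (L : language) (M : structure L) (v : nat -> M) (t : term L) : M :=
  match t with
  | Var n => v n
  | App f ts => fun_interp M f (fun i => eval v (ts i))
  end.

Fixpoint sat (L : language) (M : structure L) (v : nat -> M) (p : formula L) :
    Prop :=
  match p with
  | FBot => False
  | FEq s t => eval v s = eval v t
  | FRel r ts => rel_interp M r (fun i => eval v (ts i))
  | FImp p q => sat v p -> sat v q
  | FAll n p => forall a : M, sat (update v n a) p
  end.

Definition models (L : language) (M : structure L) (T : set (formula L)) : Prop :=
  forall p, T p -> forall v : nat -> M, sat v p.

(** * Saturation *)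

Definition add_constants (L : language) (C : Type) : language :=
  @Language (fun_symb L + C)%type
    (fun f => match f with inl f => fun_arity f | inr _ => 0 end)
    (rel_symb L) (@rel_arity L).

(* The structure (N, a)_{a in A}. *)
Definition with_params (L : language) (N : structure L) (A : set N) :
    structure (add_constants L {a : N | A a}) :=
  @Structure (add_constants L {a : N | A a}) N (carrier_inh N)
    (fun f => match f with
              | inl f => fun xs => fun_interp N f xs
              | inr c => fun _ => sval c
              end)
    (fun r => rel_interp N r).

Section Saturation.
Variables (L : language) (N : structure L) (A : set N).

(* Variable 0 is the variable of a 1-type. *)
Definition realizes (a : N)
    (G : set (formula (add_constants L {a : N | A a}))) : Prop :=
  forall p, G p -> @sat _ (with_params A) (fun=> a) p.

Definition is_type (G : set (formula (add_constants L {a : N | A a}))) : Prop :=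
  (forall p, G p -> fv p `<=` [set 0%N]) /\
  (forall H, finite_set H -> H `<=` G -> exists a, realizes a H).

End Saturation.

(* |K|-saturated: every 1-type over fewer than |K| parameters is realized. *)
Definition saturated (K : Type) (L : language) (N : structure L) : Prop :=
  forall A : set N, card_lt A [set: K] ->
  forall G, is_type (A := A) G -> exists a, realizes a G.

(** * Ultrapowers *)

Section Ultrapower.
Variables (I : Type) (D : set_system I) (L : language) (M : structure L).

(* The class of f modulo equality on a member of D. *)
Definition uclass (f : I -> M) : set (I -> M) :=
  [set g | D [set i | f i = g i]].

Definition ucarrier : Type := {C : set (I -> M) | exists f, C = uclass f}.

Definition upi (f : I -> M) : ucarrier :=
  exist _ (uclass f) (ex_intro _ f erefl).

Definition urepr (x : ucarrier) : I -> M := sval (cid (svalP x)).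

Lemma ucarrier_inh : inhabited ucarrier.
Proof. by case: (carrier_inh M) => a; exact: inhabits (upi (fun=> a)). Qed.

Definition ultrapower : structure L :=
  @Structure L ucarrier ucarrier_inh
    (fun f xs => upi (fun i => fun_interp M f (fun k => urepr (xs k) i)))
    (fun r xs => D [set i | rel_interp M r (fun k => urepr (xs k) i)]).

Definition diag (a : M) : ultrapower := upi (fun=> a).

End Ultrapower.

(* A regular family is indexed by the underlying set I of the filter. *)
Definition regular_filter (I : Type) (D : set_system I) : Prop :=
  exists X : I -> set I,
    (forall i, D (X i)) /\ (forall t, finite_set [set i | X i t]).

(* |I|^+-saturation of M^I/D, for every model M of T. *)
Definition saturates (I : Type) (D : set_system I) (L : language)
    (T : set (formula L)) : Prop :=
  forall M : structure L, models M T ->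
  forall K : Type, is_succ_card I K -> saturated K (ultrapower D M).

(** * One binary relation *)

Definition binary_language : language :=
  @Language void (fun=> 0) unit (fun=> 2).

Definition pair_fun (T : Type) (x y : T) : 'I_2 -> T :=
  fun i => if i == ord0 then x else y.

Definition binary_structure (T : Type) (inhT : inhabited T)
    (R : T -> T -> Prop) : structure binary_language :=
  @Structure binary_language T inhT
    (fun f : void => match f with end)
    (fun _ xs => R (xs ord0) (xs ord_max)).

Definition rel_of (N : structure binary_language) (x y : N) : Prop :=
  rel_interp N tt (pair_fun x y).

Definition FR (s t : term binary_language) : formula binary_language :=
  @FRel binary_language tt (pair_fun s t).

(** * The lower cofinality of aleph_0 *)

Definition omega : structure binary_language :=
  binary_structure (inhabits 0%N) (fun m n : nat => (m < n)%N).

Section Lcf.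
Variables (I : Type) (D : set_system I).
Local Notation N := (ultrapower D omega).

Definition above_omega : set N :=
  [set x | forall n : nat, rel_of (diag D (n : omega)) x].

Definition coinitial_in (S C : set N) : Prop :=
  C `<=` S /\ forall x, S x -> exists2 y, C y & (y = x \/ rel_of y x).

(* |K| is the least cardinality of a coinitial subset of [above_omega]. *)
Definition is_lcf (K : Type) : Prop :=
  (exists C, coinitial_in above_omega C /\ C #= [set: K]) /\
  (forall C, coinitial_in above_omega C -> [set: K] #<= C).

End Lcf.

(** * The theory of the random graph *)

Definition rg_irrefl : formula binary_language :=
  FAll 0 (FNot (FR (Var 0) (Var 0))).

Definition rg_sym : formula binary_language :=
  FAll 0 (FAll 1 (FImp (FR (Var 0) (Var 1)) (FR (Var 1) (Var 0)))).

(* For x_1, ..., x_n distinct from y_1, ..., y_m, some vertex z is adjacent to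
   all the x_i, and is different from and not adjacent to all the y_j.  The
   x_i are the variables 1, ..., n, the y_j are n+1, ..., n+m, and z is 0. *)
Definition rg_ext (n m : nat) : formula binary_language :=
  FAlls (iota 1 (n + m))
    (FImp
      (FConj [seq FNot (FEq (Var i) (Var j)) | i <- iota 1 n, j <- iota n.+1 m])
      (FEx 0
        (FAnd
          (FConj [seq FR (Var 0) (Var i) | i <- iota 1 n])
          (FConj [seq FAnd (FNot (FEq (Var 0) (Var j)))
                           (FNot (FR (Var 0) (Var j))) | j <- iota n.+1 m])))).

Definition random_graph_theory : set (formula binary_language) :=
  [set p | p = rg_irrefl \/ p = rg_sym \/ exists n m, p = rg_ext n m].

(* Main.v *)
Require Import Defs.
From mathcomp Require Import wochoice.

(** Fix lambda = |I| and index coordinates by Omega, a well-order of type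
    lambda^+.  An independent family (f_w) of functions I -> nat, together with
    a maximal filter modulo which it stays independent, gives a Boolean
    homomorphism Phi from the subsets of I to the subsets of [Omega -> nat]
    sending {f_w = n} to {y | y w = n} and such that every Phi A depends only on
    countably many coordinates.  The ultrafilter on I is the preimage under Phi
    of an iterated Fubini product V, along Omega, of a nonprincipal ultrafilter
    on nat, in which each new coordinate is quantified before all earlier ones.

    In the ultrapower a coordinate is then a nonstandard number below every
    nonstandard number depending only on earlier coordinates.  As lambda many
    countable supports are bounded in Omega, this gives lcf >= lambda^+.

    For the random graph, take the elements f_w for w in the first mu^++ points
    of Omega, and ask for a vertex joined to f_w exactly when w has uncountable
    cofinality.  A realization gives sets b_w in the ultrafilter, with countable
    supports S_w, such that b_v, b_w and {f_v = f_w} have empty intersection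
    whenever exactly one of v, w has uncountable cofinality.  A closure argument
    (this is where mu^++ is needed) yields a < b, of which only b has uncountable
    cofinality, with b not in S_a and no point of S_b in [a, b).  Quantifying
    along the Fubini product, one can choose the values of the coordinates a
    and b equal while staying in both Phi b_a and Phi b_b, a contradiction. *)

Set Implicit Arguments.
Unset Strict Implicit.
Unset Printing Implicit Defensive.

Local Open Scope classical_set_scope.
Local Open Scope card_scope.

(** * Cardinals *)

Lemma card_leI T U (A : set T) (B : set U) (f : T -> U) :
  (forall x, A x -> B (f x)) ->
  (forall x y, A x -> A y -> f x = f y -> x = y) -> A #<= B.
Proof.
move=> fAB finj; have [g] : $|{injfun A >-> B}|.
  apply/injfunPex; exists f => //.
  by move=> x y /set_mem Ax /set_mem Ay; exact: finj.
exact: inj_card_le.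
Qed.

Lemma card_le_nonempty T U (A : set T) (B : set U) x :
  A #<= B -> A x -> B !=set0.
Proof.
move=> /card_leP[f] Ax; exists (val (f (SigSub (mem_set Ax)))).
exact: set_valP.
Qed.

Lemma card_leE T U (u : U) (A : set T) (B : set U) : A #<= B ->
  exists f : T -> U, (forall x, A x -> B (f x)) /\
    (forall x y, A x -> A y -> f x = f y -> x = y).
Proof.
move=> /card_leP[g].
pose f x := if pselect (A x) is left Ax then val (g (SigSub (mem_set Ax))) else u.
exists f; split=> [x Ax|x y Ax Ay]; rewrite /f.
  by case: pselect => // ?; apply: set_valP.
case: pselect => // Ax'; case: pselect => // Ay'.
move=> /val_inj /(inj (f := g)); rewrite !inE => /(_ I I) [].
by [].
Qed.

(* A maximal set of choice functions that pairwise differ at every index has a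
   coordinate projection onto some [C j]; every projection is injective. *)
Lemma least_card (J : Type) (C : J -> Type) : J ->
  exists j, forall k, [set: C j] #<= [set: C k].
Proof.
move=> j0.
pose P (Z : set (forall j, C j)) :=
  forall z z', Z z -> Z z' -> forall j, z j = z' j -> z = z'.
have [F FP Ftot|Z [PZ Zmax]] := @Zorn_bigcup _ P.
  move=> z z' [X FX Xz] [Y FY Yz'].
  by have [XY|YX] := Ftot _ _ FX FY; [apply: (FP Y)|apply: (FP X)] => //;
    [exact: XY|exact: YX].
have [[j jsurj]|nsurj] := pselect (exists j, forall c : C j, exists2 z, Z z & z j = c).
  exists j => k.
  have /choice[g gP] : forall c : C j, exists z, Z z /\ z j = c.
    by move=> c; have [z ? ?] := jsurj c; exists z.
  apply: (@card_leI _ _ _ _ (fun c => g c k)) => // c c' _ _ gcc'.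
  have [Zc <-] := gP c; have [Zc' <-] := gP c'.
  by rewrite (PZ _ _ Zc Zc' _ gcc').
have /all_sig[w wP] : forall j, {c : C j | ~ exists2 z, Z z & z j = c}.
  move=> j; apply: cid; apply/existsNP => jsurj; apply: nsurj; exists j => c.
  exact: jsurj.
have Zw : ~ Z w by move=> Zw; apply: (wP j0); exists w.
case: (Zmax (w |` Z)).
  by split=> [z Zz|/(_ w)]; [right|move=> wZ; apply/Zw/wZ; left].
move=> z z' [->|Zz] [->|Zz'] j // zz'; last exact: PZ zz'.
  by case: (wP j); exists z'.
by case: (wP j); exists z.
Qed.

(** Apply [least_card] to the two sets as a family indexed by [bool]. *)
Lemma card_le_total T U (A : set T) (B : set U) : A #<= B \/ B #<= A.
Proof.
have [[] le] := @least_card bool (fun b => if b then A : Type else B : Type) true.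
- left; have := le false; rewrite (card_le_eql (card_setT A)).
  by rewrite (card_le_eqr (card_setT B)).
- right; have := le true; rewrite (card_le_eql (card_setT B)).
  by rewrite (card_le_eqr (card_setT A)).
Qed.

(** * The square of an infinite cardinal *)

Section Square.
Variable T : Type.
Implicit Type G : set (T * T * T).

(* G is the graph of a partial pairing function; its domain is the square of
   dom G. *)
Let dom G : set T := [set x | exists z, G (x, x, z)].

Let good G := [/\ [set: nat] #<= dom G,
  (forall x y, dom G x -> dom G y -> exists z, G (x, y, z)),
  (forall x y z, G (x, y, z) -> [/\ dom G x, dom G y & dom G z]),
  (forall p z z', G (p, z) -> G (p, z') -> z = z') &
  (forall p p' z, G (p, z) -> G (p', z) -> p = p')].

(** An injection [h] copies [dom G] outside itself. The new pairs, those with a coordinate in the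
    copy, form three blocks, each of the size of the square of [dom G]; the pairing already present
    codes them into the copy, away from all old values. *)
Lemma square_extend G : good G -> dom G #<= ~` dom G ->
  exists2 G', good G' & G `<` G'.
Proof.
move=> [natG tot sub func inj] leG.
have [e [edom einj]] : exists e : nat -> T, (forall n, dom G (e n)) /\ injective e.
  have [t _] := card_le_nonempty natG (I : [set: nat] 0%N).
  have [e [e1 e2]] := card_leE t natG; exists e; split=> [n|n m]; first exact: e1.
  exact: e2.
have [h [hdom hinj]] := card_leE (e 0%N) leG.
have [f fP] : exists f : T * T -> T, forall x y, dom G x -> dom G y -> G (x, y, f (x, y)).
  have /choice[f fP] : forall p, exists z, dom G p.1 -> dom G p.2 -> G (p, z).
    move=> [x y] /=; have [[Gx Gy]|nG] := pselect (dom G x /\ dom G y).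
      by have [z] := tot _ _ Gx Gy; exists z.
    by exists x => Gx Gy; case: nG.
  by exists f => x y; exact: (fP (x, y)).
have fdom x y : dom G x -> dom G y -> dom G (f (x, y)).
  by move=> Gx Gy; have [] := sub _ _ _ (fP _ _ Gx Gy).
have finj x y x' y' : dom G x -> dom G y -> dom G x' -> dom G y' ->
    f (x, y) = f (x', y') -> x = x' /\ y = y'.
  move=> Gx Gy Gx' Gy' ff; have := fP _ _ Gx Gy; rewrite ff => H.
  by have [-> ->] := inj _ _ _ H (fP _ _ Gx' Gy').
(* [sel] chooses between a point and its copy; the number [b + 2 * c] in [v] records the block. *)
pose sel (b : bool) x := if b then h x else x.
pose v (b c : bool) x y := h (f (e (b + 2 * c)%N, f (x, y))).
pose New := [set t | exists b c x y, [/\ dom G x, dom G y, b || c &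
  t = (sel b x, sel c y, v b c x y)]].
have selinj b c x y : dom G x -> dom G y -> sel b x = sel c y -> b = c /\ x = y.
  move=> Gx Gy; case: b; case: c => //= hxy.
  - by split=> //; exact: hinj.
  - by have := hdom _ Gx; rewrite /= hxy.
  - by have := hdom _ Gy; rewrite /= -hxy.
have domNew b x : dom G x -> dom (G `|` New) (sel b x).
  move=> Gx; case: b => /=; last by case: Gx => z Gz; exists z; left.
  by exists (v true true x x); right; exists true, true, x, x.
have domE t : dom (G `|` New) t -> exists b x, dom G x /\ t = sel b x.
  move=> [z [Gz|[b [c [x [y [Gx Gy _ [-> _ _]]]]]]]]; last by exists b, x.
  by exists false, t; split=> //; exists z.
have newN b c x y z : dom G x -> dom G y -> b || c -> ~ G (sel b x, sel c y, z).
  move=> Gx Gy bc /sub [Gb Gc _]; case: b bc Gb => /= [_ /(hdom _ Gx)//|].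
  by case: c Gc => //= /(hdom _ Gy).
have newI b c x y b' c' x' y' : dom G x -> dom G y -> dom G x' -> dom G y' ->
    v b c x y = v b' c' x' y' -> [/\ b = b', c = c', x = x' & y = y'].
  move=> Gx Gy Gx' Gy' /hinj H.
  have /finj[] := H (fdom _ _ (edom _) (fdom _ _ Gx Gy))
    (fdom _ _ (edom _) (fdom _ _ Gx' Gy')); try exact: edom; try exact: fdom.
  move=> /einj bc /finj[]// -> ->.
  by clear H; case: b bc; case: c; case: b'; case: c'.
exists (G `|` New); last first.
  split=> [t Gt|GN]; first by left.
  have Ge : dom G (e 0%N) by exact: edom.
  apply: (@newN true true (e 0%N) (e 0%N) (v true true (e 0%N) (e 0%N))) => //.
  by apply: GN; right; exists true, true, (e 0%N), (e 0%N).
split.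
- apply: card_le_trans natG _; apply: subset_card_le => x [z Gz].
  by exists z; left.
- move=> t u /domE[b [x [Gx ->]]] /domE[c [y [Gy ->]]].
  have [bc|/norP[/negbTE-> /negbTE->]] := boolP (b || c).
    by exists (v b c x y); right; exists b, c, x, y.
  by have [z Gz] := tot _ _ Gx Gy; exists z; left.
- move=> t u z [/sub[Gt Gu Gz]|[b [c [x [y [Gx Gy bc [-> -> ->]]]]]]].
    by split; exact: (domNew false).
  split; [exact: domNew|exact: domNew|].
  by apply: (domNew true); apply: (fdom) => //; exact: fdom.
- move=> p z z' [Gp|[b [c [x [y [Gx Gy bc [-> ->]]]]]]].
    move=> [|[b [c [x [y [Gx Gy bc [pE _]]]]]]]; first exact: func.
    by case: (@newN b c x y z) => //; rewrite -pE.
  move=> [/newN//|[b' [c' [x' [y' [Gx' Gy' bc' [E1 E2 ->]]]]]]]; first by case.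
  have [-> ->] := selinj _ _ _ _ Gx Gx' E1.
  by have [-> ->] := selinj _ _ _ _ Gy Gy' E2.
- have vN b c x y p : dom G x -> dom G y -> ~ G (p, v b c x y).
    case: p => p q Gx Gy /sub[_ _].
    by apply: hdom; apply: (fdom) => //; exact: fdom.
  move=> p p' z [Gp|[b [c [x [y [Gx Gy bc [-> ->]]]]]]].
    move=> [|[b [c [x [y [Gx Gy bc [_ zE]]]]]]]; first exact: inj.
    by case: (vN b c x y p) => //; rewrite -zE.
  move=> [/vN//|[b' [c' [x' [y' [Gx' Gy' bc' [-> E]]]]]]]; first by case.
  by have [-> -> -> ->] := newI _ _ _ _ _ _ _ _ Gx Gy Gx' Gy' E.
Qed.

Lemma card_square : infinite_card T -> [set: T * T] #<= [set: T].
Proof.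
move=> /infiniteP natT.
have domS (G G' : set (T * T * T)) : G `<=` G' -> dom G `<=` dom G'.
  by move=> GG' x [z Gz]; exists z; exact: GG'.
have [G0 goodG0] : exists G0, good G0.
  have [t _] := card_le_nonempty natT (I : [set: nat] 0%N).
  have [e [_ einj]] := card_leE t natT.
  have [c [_ cinj]] : exists c : nat * nat -> nat, (forall p, setT p -> setT (c p)) /\
      (forall p q, setT p -> setT q -> c p = c q -> p = q).
    by apply: (card_leE 0%N); have := card_nat2; rewrite card_eqPle => -[].
  pose G0 : set (T * T * T) := [set t | exists n m, t = (e n, e m, e (c (n, m)))].
  have domG0 n : dom G0 (e n) by exists (e (c (n, n))), n, n.
  have domE x : dom G0 x -> exists n, x = e n by move=> [z [n [m [-> _ _]]]]; exists n.
  exists G0; split.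
  - by apply: (@card_leI _ _ _ _ e) => // n m _ _; apply: einj.
  - by move=> x y /domE[n ->] /domE[m ->]; exists (e (c (n, m))), n, m.
  - by move=> x y z [n [m [-> -> ->]]]; split; exact: domG0.
  - move=> [x y] z z' [n [m [-> -> ->]]] [n' [m' [nn' mm' ->]]].
    by rewrite (einj _ _ I I (nn')) (einj _ _ I I mm').
  - move=> [x y] [x' y'] z [n [m [-> -> ->]]] [n' [m' [-> -> E]]].
    by have [-> ->] := cinj _ _ I I (einj _ _ I I (E)).
have [F FP Ftot|G [PG Gmax]] := @Zorn_bigcup _ [set G | G = set0 \/ good G].
  have Fgood H t : F H -> H t -> good H.
    by move=> FH Ht; case: (FP _ FH) => // H0; rewrite H0 in Ht.
  have [[H0 [FH0 [t0 H0t]]]|F0] := pselect (exists H, F H /\ H !=set0); last first.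
    left; rewrite -subset0 => t [H FH Ht]; apply: F0.
    by exists H; split=> //; exists t.
  have F2 H H' : F H -> F H' -> exists K, [/\ F K, H `<=` K & H' `<=` K].
    move=> FH FH'; have [HH'|H'H] := Ftot _ _ FH FH'; first by exists H'; split=> // ?.
    by exists H; split=> // ?.
  have Fdom H : F H -> dom H `<=` dom (\bigcup_(X in F) X).
    by move=> FH; apply: domS => t Ht; exists H.
  have domF x : dom (\bigcup_(X in F) X) x -> exists H, F H /\ dom H x.
    by move=> [z [H FH Hz]]; exists H; split=> //; exists z.
  right; split.
  - have [nat0 _ _ _ _] := Fgood _ _ FH0 H0t.
    by apply: card_le_trans nat0 (subset_card_le _); exact: Fdom.
  - move=> x y /domF[H [FH Hx]] /domF[H' [FH' Hy]].
    have [K [FK HK H'K]] := F2 _ _ FH FH'.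
    case: (Hx) => z Hz; have [_ totK _ _ _] := Fgood _ _ FK (HK _ Hz).
    by have [w Kw] := totK _ _ (domS _ _ HK _ Hx) (domS _ _ H'K _ Hy); exists w, K.
  - move=> x y z [H FH Hxyz]; have [_ _ subH _ _] := Fgood _ _ FH Hxyz.
    by have [Hx Hy Hz] := subH _ _ _ Hxyz; split; exact: Fdom FH _ _.
  - move=> p z z' [H FH Hz] [H' FH' Hz']; have [K [FK HK H'K]] := F2 _ _ FH FH'.
    have [_ _ _ fK _] := Fgood _ _ FK (HK _ Hz).
    by apply: (fK p); [exact: HK|exact: H'K].
  - move=> p p' z [H FH Hz] [H' FH' Hz']; have [K [FK HK H'K]] := F2 _ _ FH FH'.
    have [_ _ _ _ iK] := Fgood _ _ FK (HK _ Hz).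
    by apply: (iK _ _ z); [exact: HK|exact: H'K].
have {}PG : good G.
  case: PG => // G_0; case: (Gmax G0); last by right.
  rewrite G_0; split=> // sub; case: goodG0 => natG0 _ _ _ _.
  have /infiniteP[] := natG0; suff -> : dom G0 = set0 by exact: finite_set0.
  by rewrite -subset0 => x [z /sub].
(* Maximality excludes a complement at least as large as [dom G]; otherwise all of [T] embeds in
   [dom G], whose pairing then suffices. *)
have [leG|geG] := card_le_total (dom G) (~` dom G).
  by have [G' goodG' ltG] := square_extend PG leG; case: (Gmax _ ltG); right.
case: (PG) => natG tot sub func inj.
have [t _] := card_le_nonempty natG (I : [set: nat] 0%N).
have [e [edom einj]] := card_leE t natG.
have /choice[f fP] : forall p, exists z, dom G p.1 -> dom G p.2 -> G (p, z).
  move=> [x y] /=; have [[Gx Gy]|nG] := pselect (dom G x /\ dom G y).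
    by have [z] := tot _ _ Gx Gy; exists z.
  by exists x => Gx Gy; case: nG.
have fdom x y : dom G x -> dom G y -> dom G (f (x, y)).
  by move=> Gx Gy; have [] := sub _ _ _ (fP (x, y) Gx Gy).
have finj x y x' y' : dom G x -> dom G y -> dom G x' -> dom G y' ->
    f (x, y) = f (x', y') -> x = x' /\ y = y'.
  move=> Gx Gy Gx' Gy' ff; have := fP (x, y) Gx Gy; rewrite ff => H.
  by have [-> ->] := inj _ _ _ H (fP (x', y') Gx' Gy').
have [h [hdom hinj]] := card_leE t geG.
(* The tag [e (b x)] separates the points of [dom G] from those brought into it by [h]. *)
have [k [kdom kinj]] : exists k : T -> T, (forall x, dom G (k x)) /\ injective k.
  pose b (x : T) : bool := `[< dom G x >].
  pose k x := f (e (b x), if b x then x else h x).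
  have gdom x : dom G (if b x then x else h x).
    by rewrite /b; case: asboolP => // /hdom.
  exists k; split=> [x|x y /finj[]]; rewrite /k; try exact: edom; try exact: gdom.
    by apply: (fdom); [exact: edom|exact: gdom].
  move=> /einj; rewrite /b; do 2 case: asboolP => //=; move=> ? ? bE.
  - by have := bE I I.
  - by have := bE I I.
  - by move=> /hinj; exact.
apply: (@card_leI _ _ _ _ (fun p => f (k p.1, k p.2))) => // -[x y] [x' y'] _ _ /=.
by move=> /finj[]; try exact: kdom; move=> /kinj -> /kinj ->.
Qed.

End Square.

Section InfiniteCard.
Variable K : Type.
Hypothesis Kinf : infinite_card K.

Lemma nat_card_le : [set: nat] #<= [set: K].
Proof. exact/infiniteP. Qed.

(** A point is coded by a chosen index together with its place in that member of the family. *)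
Lemma bigcup_card_le (J T : Type) (D : set J) (F : J -> set T) :
  D #<= [set: K] -> (forall j, D j -> F j #<= [set: K]) ->
  \bigcup_(j in D) F j #<= [set: K].
Proof.
move=> DK FK; have [k0 _] := infinite_setN0 Kinf.
have [d [_ dinj]] := card_leE k0 DK.
have [s [_ sinj]] := card_leE (k0, k0) (card_lexx [set: K * K]).
have [q [_ qinj]] := card_leE k0 (card_square Kinf).
have /choice[f fP] : forall j, exists f : T -> K, D j ->
    forall x y, F j x -> F j y -> f x = f y -> x = y.
  move=> j; have [Dj|nDj] := pselect (D j); last by exists (fun=> k0).
  by have [f [_ fI]] := card_leE k0 (FK _ Dj); exists f.
have [[j0 Dj0]|D0] := pselect (exists j, D j); last first.
  suff -> : \bigcup_(j in D) F j = set0 by exact: card_ge0.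
  by rewrite -subset0 => x [j Dj _]; apply: D0; exists j.
have /choice[i iP] : forall x, exists j, (\bigcup_(j in D) F j) x -> D j /\ F j x.
  by move=> x; have [[j Dj Fj]|nx] := pselect ((\bigcup_(j in D) F j) x); [exists j|exists j0].
apply: (@card_leI _ _ _ _ (fun x => q (d (i x), f (i x) x))) => // x y.
move=> /iP[Dx Fx] /iP[Dy Fy] /(qinj _ _ I I)[/dinj-/(_ Dx Dy) ixy].
by rewrite -ixy; apply: fP => //; rewrite ixy.
Qed.

Lemma setU_card_le T (A B : set T) :
  A #<= [set: K] -> B #<= [set: K] -> A `|` B #<= [set: K].
Proof.
move=> AK BK; suff -> : A `|` B = \bigcup_(b in [set: bool]) (if b then A else B).
  apply: bigcup_card_le => [|[]//]; apply: card_le_trans nat_card_le; exact: countableP.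
apply/seteqP; split=> [x [Ax|Bx]|x [[] _]]; by [exists true|exists false|left|right].
Qed.

Lemma countable_card_le T (A : set T) : countable A -> A #<= [set: K].
Proof. by move=> /card_le_trans; apply; exact: nat_card_le. Qed.

Lemma seq_card_le : [set: seq K] #<= [set: K].
Proof.
have [k0 _] := infinite_setN0 Kinf.
have [q [_ qinj]] := card_leE k0 (card_square Kinf).
have -> : [set: seq K] = \bigcup_(n in [set: nat]) [set s | size s = n].
  by apply/seteqP; split=> // s _; exists (size s).
apply: bigcup_card_le => [|n _]; first exact: nat_card_le.
apply: (@card_leI _ _ _ _ (foldr (fun x y => q (x, y)) k0)) => //.
elim: n => [|n IH] [|x s] [|y t] //= [sn] [tn] /(qinj _ _ I I)[-> st].
by congr cons; exact: IH.
Qed.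

Lemma prod_card_le X Y : [set: X] #<= [set: K] -> [set: Y] #<= [set: K] ->
  [set: X * Y] #<= [set: K].
Proof.
move=> XK YK; have [k0 _] := infinite_setN0 Kinf.
have [f [_ finj]] := card_leE k0 XK; have [g [_ ginj]] := card_leE k0 YK.
apply: card_le_trans (card_square Kinf).
apply: (@card_leI _ _ _ _ (fun p => (f p.1, g p.2))) => // -[x y] [x' y'] _ _ /=.
by case=> /finj-> // /ginj->.
Qed.

End InfiniteCard.

(** Cantor's diagonal argument, with the set of codes of those sets that omit their own code. *)
Lemma card_powerset_nle T : ~ ([set: set T] #<= [set: T]).
Proof.
move=> le; have [t _] := card_le_nonempty le (I : [set: set T] set0).
have [f [_ finj]] := card_leE t le.
pose B := [set x | exists2 A, f A = x & ~ A x].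
have [Bf|nBf] := pselect (B (f B)); last by apply: (nBf); exists B.
by case: (Bf) => A /(finj _ _ I I) ->; apply.
Qed.

(** * Well-orders *)

Record strict_well_order T (lt : T -> T -> Prop) : Prop := StrictWellOrder {
  swo_wf : well_founded lt;
  swo_trans : forall y x z, lt x y -> lt y z -> lt x z;
  swo_total : forall x y, [\/ lt x y, x = y | lt y x] }.

Lemma exists_strict_well_order T : exists lt : T -> T -> Prop, strict_well_order lt.
Proof.
elim/Peq: T => T.
have [R Rwo] := well_ordering_principle T.
have RwoT : wo_chain R predT by move=> A _; exact: Rwo.
have Rtot x y : R x y || R y x by exact: (wo_chainW RwoT).
have Ranti x y : R x y -> R y x -> x = y.
  by move=> xy yx; apply: (wo_chain_antisymmetric RwoT) => //; rewrite xy yx.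
exists (fun x y => ~~ R y x); split.
- move=> x; apply: contrapT => nx.
  have [|z [[]]] := Rwo [pred x | `[< ~ Acc (fun x y => ~~ R y x) x >]].
    by exists x; exact/asboolP.
  move=> /asboolP nz zmin _; apply: nz; constructor => y Ryz.
  apply: contrapT => ny; move/negP: Ryz; apply; apply: zmin.
  exact/asboolP.
- move=> y x z yx zy; apply/negP => zx.
  (* Transitivity is read off from the least of the three points. *)
  have [|m [[]]] := Rwo (mem [:: x; y; z]); first by exists x; rewrite inE eqxx.
  rewrite !inE => /or3P[] /eqP-> mmin _.
  + have xz : R x z by apply: mmin; rewrite !inE eqxx !orbT.
    have xy : R x y by apply: mmin; rewrite !inE eqxx !orbT.
    by move: zy; rewrite -(Ranti _ _ xz zx) xy.
  + by move: yx; rewrite mmin // !inE eqxx.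
  + by move: zy; rewrite mmin // !inE eqxx !orbT.
- move=> x y; case Rxy: (R x y); last by apply: Or33.
  case Ryx: (R y x); last by apply: Or31.
  by apply: Or32; exact: Ranti.
Qed.

Section WellOrder.
Variables (T : Type) (lt : T -> T -> Prop).
Hypothesis ltP : strict_well_order lt.

Local Notation "x ≺ y" := (lt x y) (at level 70, no associativity).
Local Notation "x ≼ y" := (x ≺ y \/ x = y) (at level 70, no associativity).

Lemma wo_irrefl x : ~ x ≺ x.
Proof. by elim/(well_founded_ind (swo_wf ltP)): x => x IH xx; exact: (IH x). Qed.

Lemma wo_leNgt x y : ~ x ≺ y -> y ≼ x.
Proof. by case: (swo_total ltP x y) => [//|->|]; [right|left]. Qed.

Lemma wo_ltNge x y : x ≺ y -> ~ y ≼ x.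
Proof.
by move=> xy [/(swo_trans ltP xy)/wo_irrefl//|yx]; move: xy; rewrite yx; exact: wo_irrefl.
Qed.

Lemma wo_le_lt_trans y x z : x ≼ y -> y ≺ z -> x ≺ z.
Proof. by move=> [xy|->//]; exact: swo_trans. Qed.

Lemma wo_lt_le_trans y x z : x ≺ y -> y ≼ z -> x ≺ z.
Proof. by move=> xy [yz|<-//]; exact: swo_trans yz. Qed.

Lemma wo_least (A : set T) : A !=set0 ->
  exists2 x, A x & forall y, A y -> x ≼ y.
Proof.
move=> [x Ax]; apply: contrapT => nA.
elim/(well_founded_ind (swo_wf ltP)): x Ax => x IH Ax.
by apply: nA; exists x => // y Ay; apply: wo_leNgt => /IH.
Qed.

(** Transfinite recursion with choice: the constraint at a point may refer only to earlier values,
    and a new value is required only when the earlier ones landed in [B]. *)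
Lemma wo_rec (A B : set T) (P : T -> (T -> T) -> T -> Prop) :
  (forall x g, A x -> (forall y, y ≺ x -> A y -> B (g y)) ->
    exists2 t, B t & P x g t) ->
  (forall x g g', (forall y, y ≺ x -> g y = g' y) -> P x g `<=` P x g') ->
  exists g, forall x, A x -> B (g x) /\ P x g (g x).
Proof.
move=> ex ext.
have /choice[c cP] : forall xg : T * (T -> T), exists t, A xg.1 ->
    (forall y, y ≺ xg.1 -> A y -> B (xg.2 y)) -> B t /\ P xg.1 xg.2 t.
  move=> [x g] /=.
  have [[Ax Bg]|n] := pselect (A x /\ forall y, y ≺ x -> A y -> B (g y)).
    by have [t] := ex _ _ Ax Bg; exists t.
  by exists x => Ax Bg; case: n.
(* Values not yet defined are replaced by the dummy [x]; the second hypothesis makes this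
   harmless. *)
pose F x (rec : forall y, y ≺ x -> T) : T :=
  c (x, fun y => if pselect (y ≺ x) is left yx then rec y yx else x).
pose g := Fix (swo_wf ltP) _ F.
have gE x : g x = c (x, fun y => if pselect (y ≺ x) is left yx then g y else x).
  rewrite /g Fix_eq // => {}x r r' rr'; congr (c (_, _)).
  by apply: funext => y; case: pselect.
exists g; elim/(well_founded_ind (swo_wf ltP)) => x IH Ax.
have [||Bg Pg] := cP (x, fun y => if pselect (y ≺ x) is left yx then g y else x) => //=.
  by move=> y yx Ay; case: pselect => //= _; have [] := IH _ yx Ay.
rewrite gE; split=> //; apply: (ext _ _ _ _ _ Pg) => y yx /=.
by case: pselect.
Qed.

(** If [K] is infinite and [T] does not embed in it, this initial segment has order type $|K|^+$ and
    serves as a concrete successor cardinal. *)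
Definition small (K : Type) : set T := [set x | [set y | y ≺ x] #<= [set: K]].

Lemma small_lower K y x : small K x -> y ≺ x -> small K y.
Proof.
move=> Kx yx; apply: card_le_trans Kx; apply: subset_card_le => z zy /=.
exact: swo_trans yx.
Qed.

Lemma small_mono K K' : [set: K] #<= [set: K'] -> small K `<=` small K'.
Proof. by move=> KK' x; rewrite /small /= => /card_le_trans; apply. Qed.

Section Infinite.
Variable K : Type.
Hypothesis Kinf : infinite_card K.

Lemma small_le_seg x : small K x -> [set y | y ≼ x] #<= [set: K].
Proof.
move=> Kx; have -> : [set y | y ≼ x] = [set y | y ≺ x] `|` [set x] by [].
by apply: setU_card_le => //; apply: countable_card_le => //; exact: countable1.
Qed.

Hypothesis nTK : ~ ([set: T] #<= [set: K]).

(** Otherwise the least point outside [small K] would itself have at most $|K|$ predecessors. *)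
Lemma small_card_nle : ~ (small K #<= [set: K]).
Proof.
move=> leK; have [x nx xmin] : exists2 x, ~ small K x & forall y, ~ small K y -> x ≼ y.
  apply: wo_least; apply/existsNP => all.
  by apply: nTK; apply: card_le_trans leK; apply: subset_card_le => x _.
apply: nx; apply: card_le_trans leK; apply: subset_card_le => y yx.
by apply: contrapT => /xmin; exact: wo_ltNge.
Qed.

(** Regularity of $|K|^+$: an unbounded [Y] would cover the segment by $|K|$ many segments of size
    at most $|K|$. *)
Lemma small_bounded (Y : set T) : Y `<=` small K -> Y #<= [set: K] ->
  exists2 x, small K x & forall y, Y y -> y ≺ x.
Proof.
move=> Ys YK; apply: contrapT => nb; apply: small_card_nle.
apply: (@card_le_trans _ _ _ (\bigcup_(y in Y) [set z | z ≼ y])).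
  apply: subset_card_le => x sx; apply: contrapT => nx; apply: nb; exists x => // y Yy.
  by apply: contrapT => /wo_leNgt xy; apply: nx; exists y.
by apply: bigcup_card_le => // y Yy; exact/small_le_seg/Ys.
Qed.

(** Suppose [X] embeds in the segment. A bounded image would embed [X] in [K]; an unbounded one
    covers the segment by $|X|$ many segments of size at most $|K| \leq |X|$. *)
Lemma small_card_le X : ~ ([set: X] #<= [set: K]) -> small K #<= [set: X].
Proof.
move=> nXK.
have [//|XleS] := card_le_total (small K) [set: X].
have KX : [set: K] #<= [set: X] by case: (card_le_total [set: K] [set: X]).
have [k _] := infinite_setN0 Kinf; have [t _] := card_le_nonempty KX (I : [set: K] k).
have [t' _] := card_le_nonempty XleS (I : [set: X] t).
have [e [edom einj]] := card_leE t' XleS.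
have Xinf : infinite_card X by apply/infiniteP; apply: card_le_trans KX; exact/infiniteP.
have [[x Kx xub]|nb] := pselect (exists2 x, small K x & forall a, e a ≺ x).
  case: nXK; apply: card_le_trans Kx; apply: (card_leI (f := e)) => // a _; exact: xub.
apply: (@card_le_trans _ _ _ (\bigcup_(a in [set: X]) [set z | z ≼ e a])).
  apply: subset_card_le => x sx; apply: contrapT => nx; apply: nb; exists x => // a.
  by apply: contrapT => /wo_leNgt xy; apply: nx; exists a.
apply: bigcup_card_le => // a _; apply: card_le_trans KX.
by apply: small_le_seg; exact: edom.
Qed.

Lemma small_succ_card : is_succ_card K (small K).
Proof.
have sE X (A : set X) : ([set: small K] #<= A) = (small K #<= A).
  exact: card_le_eql (card_setT _).
split=> [|X [_ nXK]]; last by rewrite sE; exact: small_card_le.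
split; last by rewrite sE; exact: small_card_nle.
rewrite (card_le_eqr (card_setT _)).
by have [//|le] := card_le_total [set: K] (small K); case: small_card_nle.
Qed.

End Infinite.
End WellOrder.

(** * Free pairs for set mappings with countable values *)

Section FreePair.
Variables (T K : Type) (lt : T -> T -> Prop).
Hypothesis ltP : strict_well_order lt.
Hypotheses (Kinf : infinite_card K) (nTK : ~ ([set: T] #<= [set: K])).
Hypothesis nK : ~ countable [set: K].

Local Notation "x ≺ y" := (lt x y) (at level 70, no associativity).
Local Notation "x ≼ y" := (x ≺ y \/ x = y) (at level 70, no associativity).

(** Least points and successors fail this too: take [Y] empty, or the predecessor alone. *)
Definition uncountable_cofinality (x : T) := forall Y : set T, countable Y ->
  (forall y, Y y -> y ≺ x) -> exists2 z, z ≺ x & forall y, Y y -> y ≺ z.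

Let Theta : set T := small lt K.
Let Omega1 : set T := small lt nat.

Let nat_infinite : infinite_card nat. Proof. exact: infinite_nat. Qed.

Let nTnat : ~ ([set: T] #<= [set: nat]).
Proof. by move=> TN; apply: nTK; apply: card_le_trans TN _; exact/infiniteP. Qed.

Let Omega1K : Omega1 #<= [set: K].
Proof. exact: small_card_le. Qed.

(** Along the countable ordinals build an increasing [g] in [Theta] whose every value exceeds all
    points of [Theta] in the sets [S a] for [a] up to an earlier value. Its supremum [b] has
    cofinality $\omega_1$ and lies in no [S a] with [a] below [b]. Since [S b] is countable, it is
    bounded below [b], and [a] is taken just above such a bound. *)
Lemma free_pair (S : T -> set T) : (forall x, countable (S x)) ->
  exists a b, [/\ a ≺ b, small lt K b, ~ uncountable_cofinality a, uncountable_cofinality b &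
    ~ S a b /\ forall w, S b w -> w ≺ b -> w ≺ a].
Proof.
move=> cS.
have [||g gP] := @wo_rec _ _ ltP Omega1 Theta (fun x g t => forall y, y ≺ x -> Omega1 y ->
    g y ≺ t /\ forall a, a ≼ g y -> forall s, S a s -> Theta s -> s ≺ t).
- move=> x g Ox gT.
  pose Y := \bigcup_(y in [set y | y ≺ x])
    ([set g y] `|` \bigcup_(a in [set a | a ≼ g y]) S a) `&` Theta.
  have [||t Tt tub] := small_bounded ltP Kinf nTK (Y := Y).
  + by move=> t [].
  + apply: (@card_le_trans _ _ _ (\bigcup_(y in [set y | y ≺ x])
      (([set g y] `|` \bigcup_(a in [set a | a ≼ g y]) S a) `&` Theta))).
      by apply: subset_card_le => t [[y yx Yt] Tt]; exists y.
    apply: bigcup_card_le => // [|y yx].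
      by apply: card_le_trans Ox _; exact/infiniteP.
    have Ty := gT y yx (small_lower ltP Ox yx).
    apply: (@card_le_trans _ _ _ ([set g y] `|` \bigcup_(a in [set a | a ≼ g y]) S a)).
      by apply: subset_card_le => t [].
    apply: setU_card_le => //; first exact/countable_card_le/countable1.
    apply: bigcup_card_le => // [|a _]; last exact: countable_card_le.
    exact: small_le_seg.
  exists t => // y yx Oy; split.
    by apply: tub; split; [exists y => //; left|exact: gT].
  by move=> a ay s Sas Ts; apply: tub; split=> //; exists y => //; right; exists a.
- move=> x g g' gg' t H y yx; rewrite -gg' //; exact: H.
have gmono x y : Omega1 x -> Omega1 y -> y ≺ x -> g y ≺ g x.
  by move=> Ox Oy yx; have [_ /(_ y yx Oy)[]] := gP _ Ox.
have [|b [Tb gb] bmin] := wo_least ltP (A := [set b | Theta b /\ forall x, Omega1 x -> g x ≺ b]).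
  have [||c Tc cub] := small_bounded ltP Kinf nTK (Y := g @` Omega1).
  - by move=> _ [x Ox <-]; have [] := gP _ Ox.
  - by apply: card_le_trans (card_image_le _ _) _.
  - by exists c; split=> // x Ox; apply: cub; exists x.
have gcof a : a ≺ b -> exists2 x, Omega1 x & a ≼ g x.
  move=> ab; apply: contrapT => na; apply: (wo_ltNge ltP ab); apply: bmin.
  split; first exact: (small_lower ltP Tb ab).
  by move=> x Ox; apply: contrapT => /(wo_leNgt ltP) ?; apply: na; exists x.
have ucb : uncountable_cofinality b.
  move=> Y cY Yb.
  have /choice[h hP] : forall y, exists x, Y y -> Omega1 x /\ y ≼ g x.
    move=> y; have [Yy|nY] := pselect (Y y); last by exists b.
    by have [x Ox yx] := gcof _ (Yb _ Yy); exists x.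
  have [||x Ox xub] := small_bounded ltP nat_infinite nTnat (Y := h @` Y).
  - by move=> _ [y Yy <-]; have [] := hP _ Yy.
  - exact: card_le_trans (card_image_le _ _) cY.
  exists (g x); first exact: gb.
  move=> y Yy; have [Oh yh] := hP _ Yy.
  by apply: (wo_le_lt_trans ltP yh); apply: gmono => //; apply: xub; exists y.
have [z zb zub] := ucb (S b `&` [set w | w ≺ b])
  (sub_countable (subset_card_le (@subIsetl _ _ _)) (cS b)) (fun y => @proj2 _ _).
(* As the successor of [z], [a] does not have uncountable cofinality, and it stays below the limit
   point [b]. *)
have [|a za amin] := wo_least ltP (A := [set a | z ≺ a]); first by exists b.
have ab : a ≺ b.
  have [|c cb /(_ z erefl) zc] := ucb [set z] (countable1 z); first by move=> _ ->.
  exact: (wo_le_lt_trans ltP (amin _ zc) cb).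
exists a, b; split=> //.
- move=> /(_ [set z] (countable1 z))[|c ca /(_ z erefl) zc]; first by move=> _ ->.
  exact: (wo_ltNge ltP ca (amin _ zc)).
- split=> [Sab|w Sw wb]; last first.
    by apply: (swo_trans ltP _ za); apply: zub.
  have [x Ox ax] := gcof _ ab.
  have [||x' Ox' /(_ x erefl) xx'] := small_bounded ltP nat_infinite nTnat (Y := [set x]).
  - by move=> _ ->.
  - exact: countable1.
  have [_ /(_ x xx' Ox)[_ /(_ a ax b Sab Tb) bx']] := gP _ Ox'.
  exact: (wo_irrefl ltP (swo_trans ltP bx' (gb _ Ox'))).
Qed.

End FreePair.

(** * Independent families and a Boolean homomorphism *)

Lemma card_le_retract T U (A : set U) : T -> [set: T] #<= A ->
  exists g : U -> T, forall x, exists2 u, A u & g u = x.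
Proof.
move=> t TA; have [u _] := card_le_nonempty TA (I : [set: T] t).
have [e [eA einj]] := card_leE u TA.
have /choice[g gP] : forall u, exists x, (exists x', e x' = u) -> e x = u.
  by move=> v; have [[x xv]|nx] := pselect (exists x', e x' = v); [exists x|exists t].
exists g => x; exists (e x); first exact: eA.
by apply: einj => //; apply: gP; exists x.
Qed.

(* A point of the index set codes a finite list s of elements of I together with
   finitely many values attached to traces on s; the function attached to A
   reads off the value attached to the trace of A. *)
Lemma independent_family (I : Type) : infinite_card I ->
  exists (f : set I -> I -> nat) (X : I -> set I),
    (forall t, finite_set [set i | X i t]) /\
    forall (L : set I) (u : seq (set I)) (y : set I -> nat), finite_set L ->
      exists t, (forall i, L i -> X i t) /\ forall A, A \in u -> f A t = y A.
Proof.
elim/Pchoice: I => I Iinf.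
pose tr (A : set I) (s : seq I) := [seq `[< A i >] | i <- s].
pose rd (r : seq (seq bool * nat)) (b : seq bool) := head 0%N [seq p.2 | p <- r & p.1 == b].
have [g gP] : exists g : I -> seq I * seq (seq bool * nat),
    forall x, exists2 u, [set: I] u & g u = x.
  apply: (card_le_retract ([::], [::])); apply: prod_card_le => //; first exact: seq_card_le.
  exact: countable_card_le.
exists (fun A t => rd (g t).2 (tr A (g t).1)), (fun i t => i \in (g t).1).
split=> [t|L u y /finite_seqP[l ->]].
  exact: finite_seq.
have /choice[d dP] : forall p : set I * set I, exists i, p.1 = p.2 \/ ~ (p.1 i <-> p.2 i).
  have [i0 _] := infinite_setN0 Iinf.
  move=> [A B] /=; have [->|nAB] := pselect (A = B); first by exists i0; left.
  apply: contrapT => ni; apply: nAB; apply/predeqP => i.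
  by apply: contrapT => nABi; apply: ni; exists i; right.
pose s := l ++ [seq d (A, B) | A <- u, B <- u].
have [t _ gt] := gP (s, [seq (tr A s, y A) | A <- u]).
exists t; rewrite gt /=; split=> [i il|A Au].
  by rewrite mem_cat; apply/orP; left.
have trI A' : A' \in u -> tr A' s = tr A s -> A' = A.
  move=> A'u trE; have [//|nd] := dP (A', A).
  have ds : d (A', A) \in s by rewrite mem_cat; apply/orP; right; apply: allpairs_f.
  have /eq_in_map/(_ _ ds) := trE => /(congr1 is_true) dE.
  by case: nd => /=; split=> /asboolP; [rewrite dE|rewrite -dE] => /asboolP.
suff H v : A \in v -> all (mem u) v -> rd [seq (tr A s, y A) | A <- v] (tr A s) = y A.
  by apply: H => //; exact/allP.
rewrite /rd; elim: v => //= B v IH; rewrite inE => Av /andP[Bu vu].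
case: (tr B s =P tr A s) => [/trI->//|nB].
by apply: IH => //; case/orP: Av => // /eqP AB; case: nB; rewrite AB.
Qed.

Lemma countable_lists (U : eqType) (S : set U) : countable S ->
  countable [set l : seq (U * nat) | forall p, p \in l -> S p.1].
Proof.
move=> /countable_injP[e einj].
apply: (card_leI (f := fun l => choice.pickle [seq (e p.1, p.2) | p <- l])) => //.
move=> l l' Sl Sl' /(pcan_inj choice.pickleK); elim: l l' Sl Sl' => [|[x n] l IH] [|[x' n'] l'] //=.
move=> Sl Sl' [exx' -> ll']; congr cons.
  congr pair; apply: einj exx'; rewrite inE.
    by apply: (Sl (x, n)); rewrite mem_head.
  by apply: (Sl' (x', n')); rewrite mem_head.
by apply: IH ll' => p pl; [apply: Sl|apply: Sl']; rewrite inE pl orbT.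
Qed.

(* The involution exchanging 0 and n: it moves conditions near the zero function
   to conditions near any given y, coordinate by coordinate. *)
Definition swap0 n k := if k == 0%N then n else if k == n then 0%N else k.

Lemma swap0K n : involutive (swap0 n).
Proof.
move=> k; rewrite /swap0; have [->|k0] := eqVneq k 0%N.
  by have [->|] := eqVneq n 0%N => //; rewrite eqxx.
by have [->|kn] := eqVneq k n; rewrite ?eqxx // (negbTE k0) (negbTE kn).
Qed.

(** * Finite conditions and their cylinders modulo a filter *)

Section Cylinders.
Variables (I : Type) (T : eqType) (f : T -> I -> nat).

(* The finite partial function (u, y) is the restriction of y to u. *)
Definition cond := (seq T * (T -> nat))%type.
Implicit Types (c : cond) (A B : set I) (D : set_system I).

Definition cyl c : set I := [set i | forall w, w \in c.1 -> f w i = c.2 w].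

Definition ext c c' :=
  {subset c.1 <= c'.1} /\ forall w, w \in c.1 -> c'.2 w = c.2 w.

(** In the language of forcing, [c] forces [A]: the cylinder is contained in [A] modulo [D]. *)
Definition incl D c A := D (~` cyl c `|` A).

(** The family [f] remains independent modulo [D]. *)
Definition positive D := forall c, ~ D (~` cyl c).

Definition decided D A c := incl D c A \/ incl D c (~` A).

Lemma ext_refl c : ext c c. Proof. by split. Qed.

Lemma ext_trans c2 c1 c3 : ext c1 c2 -> ext c2 c3 -> ext c1 c3.
Proof.
move=> [s12 e12] [s23 e23]; split=> [w /s12/s23//|w w1].
by rewrite e23 ?e12 //; exact: s12.
Qed.

Lemma ext_cyl c c' : ext c c' -> cyl c' `<=` cyl c.
Proof. by move=> [s e] i ic' w wc; rewrite ic' ?e //; exact: s. Qed.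

(** Take a maximal positive filter. If no extension of [c] forces [A], adjoining the complement of
    [cyl c] intersected with [A] preserves positivity, so by maximality that complement already
    belongs to the filter and [c] forces the complement of [A]. *)
Lemma maximal_positive_filter D0 : Filter D0 -> positive D0 ->
  exists D, [/\ Filter D, D0 `<=` D, positive D &
    forall A c, exists2 c', ext c c' & decided D A c'].
Proof.
move=> FD0 posD0.
pose good D := [/\ Filter D, D0 `<=` D & positive D].
have [F FP Ftot|D [PD Dmax]] := @Zorn_bigcup _ [set D | D = set0 \/ good D].
  have Fgood H A : F H -> H A -> good H.
    by move=> FH HA; case: (FP _ FH) => // H0; rewrite H0 in HA.
  have [[H0 [FH0 [A0 H0A]]]|F0] := pselect (exists H, F H /\ H !=set0); last first.
    left; rewrite -subset0 => A [H FH HA]; apply: F0.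
    by exists H; split=> //; exists A.
  have [filH0 subH0 _] := Fgood _ _ FH0 H0A.
  right; split.
  - split.
    + by exists H0 => //; exact: filterT.
    + move=> A B [H FH HA] [H' FH' HB].
      have [filH _ _] := Fgood _ _ FH HA; have [filH' _ _] := Fgood _ _ FH' HB.
      have [HH'|H'H] := Ftot _ _ FH FH'.
        by exists H' => //; apply: filterI => //; exact: HH'.
      by exists H => //; apply: filterI => //; exact: H'H.
    + move=> A B AB [H FH HA]; exists H => //; have [filH _ _] := Fgood _ _ FH HA.
      exact: filterS HA.
  - by move=> A /subH0; exists H0.
  - by move=> c [H FH Hc]; have [_ _ /(_ c)] := Fgood _ _ FH Hc.
have {PD} [FD D0D posD] : good D.
  case: PD => // D_0; case: (Dmax D0); last by right; split.
  rewrite D_0; split=> // /(_ setT); apply; exact: filterT.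
exists D; split=> // A c.
have [[c' cc' c'A]|nc'] := pselect (exists2 c', ext c c' & incl D c' A).
  by exists c' => //; left.
exists c; first exact: ext_refl.
right.
pose N := cyl c `&` A.
pose D' : set_system I := [set Y | D (Y `|` N)].
have DD' : D `<=` D' by move=> Y; apply: filterS => i; left.
have goodD' : good D'.
  split=> //; last 2 first.
  - by move=> Y /D0D /DD'.
  - move=> q; rewrite /D' /= => Dq.
    (* If [q] contradicts [c], its cylinder misses [N] and would be null already; otherwise the
       union of [c] and [q] would force [A]. *)
    have [qc|nqc] := pselect (forall w, w \in c.1 -> w \in q.1 -> c.2 w = q.2 w); last first.
      apply: (posD q); apply: filterS Dq => i [//|[ic _] iq]; apply: nqc => w wc wq.
      by rewrite -(ic _ wc) (iq _ wq).
    apply: nc'; exists (c.1 ++ q.1, fun w => if w \in c.1 then c.2 w else q.2 w).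
      by split=> [w wc|w wc] /=; rewrite ?mem_cat wc.
    apply: filterS Dq => i [niq|[_ iA]]; last by right.
    left=> ir; apply: niq => w wq; rewrite (ir w) /=; last by rewrite mem_cat wq orbT.
    by case: ifP => // /qc; exact.
  split.
  - by rewrite /D' /=; apply: filterS filterT => i _; left.
  - move=> Y Z; rewrite /D' /= => DY DZ; apply: filterS (filterI DY DZ).
    move=> i [[Yi|Ni] [Zi|Ni']]; first [by left|by right].
  - by move=> Y Z YZ; rewrite /D' /=; apply: filterS => i [/YZ ?|?]; first [by left|by right].
have D'D : D' `<=` D.
  apply: contrapT => nD'D; apply: (Dmax D'); last by right.
  by split.
apply: (@filterS _ D FD (~` N)); last by apply: D'D; rewrite /D' /= setUC setUv; exact: filterT.
move=> i; have [ic|nic] := pselect (cyl c i); last by left.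
by move=> nNi; right=> iA; apply: nNi.
Qed.

Variable D : set_system I.
Hypothesis FD : Filter D.
Hypothesis posD : positive D.
Hypothesis decD : forall A c, exists2 c', ext c c' & decided D A c'.

Lemma ext_incl c c' A : ext c c' -> incl D c A -> incl D c' A.
Proof. by move=> /ext_cyl cc'; rewrite /incl; apply: filterS => i [ic|]; [left=> /cc'|right]. Qed.

Lemma ext_decided c c' A : ext c c' -> decided D A c -> decided D A c'.
Proof. by move=> cc' [] /(ext_incl cc') ?; [left|right]. Qed.

Lemma inclI c A B : incl D c A -> incl D c B -> incl D c (A `&` B).
Proof.
rewrite /incl => cA cB; apply: filterS (filterI cA cB) => i.
case=> -[ic|iA] [ic'|iB]; first [by left|by right].
Qed.

Lemma incl0 c : ~ incl D c set0.
Proof. by rewrite /incl setU0; exact: posD. Qed.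

Definition restr (S : set T) c : cond := ([seq w <- c.1 | `[< S w >]], c.2).

Lemma mem_restr S c w : w \in (restr S c).1 <-> w \in c.1 /\ S w.
Proof.
rewrite mem_filter; split=> [/andP[/asboolP ? ?]//|[? ?]].
by apply/andP; split=> //; apply/asboolP.
Qed.

Lemma ext_restr S c : ext (restr S c) c.
Proof. by split=> // w /mem_restr[]. Qed.

(** Close the empty set under a choice of deciding extensions for the conditions living on it. At
    each of the countably many stages only countably many conditions arise, so [S] is countable, and
    the restriction of any condition to [S] can be decided inside [S]. *)
Lemma decision_support A : exists2 S, countable S &
  forall c, exists2 c', ext c c' & decided D A (restr S c').
Proof.
have /choice[q qP] : forall c, exists c', ext c c' /\ decided D A c'.
  by move=> c; have [c' ? ?] := decD A c; exists c'.
(* A condition carries a total function; rebuilding it from a finite list, with value 0 elsewhere,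
   leaves only countably many over a countable set. *)
pose lk l (w : T) := head 0%N [seq p.2 | p <- l & p.1 == w].
pose lc (l : seq (T * nat)) : cond := (map fst l, lk l).
have lkE (y : T -> nat) u w : w \in u -> lk [seq (v, y v) | v <- u] w = y w.
  rewrite /lk; elim: u => //= v u IH; rewrite inE eq_sym.
  by case: (eqVneq v w) => [->|_ /IH].
pose Sn := fix Sn n : set T := if n is m.+1 then Sn m `|`
  \bigcup_(l in [set l : seq (T * nat) | forall p, p \in l -> Sn m p.1])
     [set` (q (lc l)).1] else set0.
pose S := \bigcup_n Sn n.
have cS : countable S.
  apply: bigcup_countable => // n _; elim: n => [|n IH] /=; first exact: countable0.
  rewrite -bigcup2E; apply: bigcup_countable => // -[|[|?]] _ //=.
  apply: bigcup_countable.
    exact: countable_lists.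
  by move=> l _; exact/finite_set_countable/finite_seq.
have Smono n m : (n <= m)%N -> Sn n `<=` Sn m.
  by move/subnK <-; elim: (m - n)%N => [|k IH] // w /IH; left.
have Sfin (u : seq T) : (forall w, w \in u -> S w) -> exists n, forall w, w \in u -> Sn n w.
  elim: u => [|w u IH] Su; first by exists 0%N.
  have [|n Hn] := IH; first by move=> v vu; apply: Su; rewrite inE vu orbT.
  have [m _ Hm] := Su w (mem_head _ _).
  exists (maxn n m) => v; rewrite inE => /orP[/eqP->|/Hn].
    by apply: Smono Hm; rewrite leq_maxr.
  by apply: Smono; rewrite leq_maxl.
have SP c : (forall w, w \in c.1 -> S w) ->
    exists c', [/\ ext c c', forall w, w \in c'.1 -> S w & decided D A c'].
  move=> Sc; have [n Hn] := Sfin _ Sc.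
  pose l := [seq (w, c.2 w) | w <- c.1].
  have [[sub e] dec] := qP (lc l).
  have lE : (lc l).1 = c.1 by rewrite /lc /l /= -map_comp map_id.
  exists (q (lc l)); split=> //.
    by split=> w wc; [apply: sub; rewrite lE|rewrite e ?lE //= lkE].
  move=> w wq; exists n.+1 => //; right; exists l => //= p /mapP[v vc ->]; exact: Hn.
exists S => // c.
have [|d [[sub e] Sd dec]] := SP (restr S c); first by move=> w /mem_restr[].
(* Since [d] lives on [S] and extends the restriction of [c] to [S], it is compatible with [c]. *)
exists (c.1 ++ d.1, fun w => if w \in d.1 then d.2 w else c.2 w).
  split=> [w wc|w wc] /=; first by rewrite mem_cat wc.
  case: ifP => // wd; rewrite e //; apply/mem_restr; split=> //; exact: Sd.
apply: ext_decided dec; split=> [w wd|w wd]; last by rewrite /= wd.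
by apply/mem_restr; split; [rewrite /= mem_cat wd orbT|exact: Sd].
Qed.

Definition shift c (y : T -> nat) : cond := (c.1, fun w => swap0 (y w) (c.2 w)).

Lemma shiftK c y : shift (shift c y) y = c.
Proof. by case: c => u z; congr pair; apply: funext => w; exact: swap0K. Qed.

Lemma ext_shift c c' y : ext c c' -> ext (shift c y) (shift c' y).
Proof. by move=> [s e]; split=> //= w /e ->. Qed.

Lemma boolean_hom : exists Phi : set I -> set (T -> nat),
  [/\ forall A B, Phi (A `&` B) = Phi A `&` Phi B,
      forall A, Phi (~` A) = ~` Phi A,
      forall A, D A -> Phi A = setT,
      forall w n, Phi [set i | f w i = n] = [set y | y w = n] &
      forall A, exists2 S, countable S & forall y y',
        (forall w, S w -> y w = y' w) -> Phi A y -> Phi A y'].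
Proof.
(* G concentrates on conditions that are long initial pieces of the zero function
   and decide everything; [Phi A] collects the y to whose neighbourhoods the
   translate of G puts A.  Deciding A on a countable S makes this depend on y
   only through S. *)
pose dense (O : set cond) := forall c, exists2 c', ext c c' & O c'.
pose opn (O : set cond) := forall c c', ext c c' -> O c -> O c'.
pose F : set_system cond := [set P | exists (u : seq T) (O : set cond),
  [/\ dense O, opn O & forall c, O c -> ext (u, fun=> 0%N) c -> P c]].
have FF : ProperFilter F.
  apply: Build_ProperFilter_ex.
    move=> P [u [O [dO _ OP]]]; have [c uc Oc] := dO (u, fun=> 0%N).
    by exists c; exact: OP.
  split.
  - by exists [::], setT; split=> // c; exists c => //; exact: ext_refl.
  - move=> P Q [u [O [dO oO OP]]] [v [O' [dO' oO' OQ]]].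
    exists (u ++ v), (O `&` O'); split.
    + move=> c; have [c1 cc1 Oc1] := dO c; have [c2 c12 O'c2] := dO' c1.
      by exists c2; [exact: ext_trans c12|split=> //; exact: oO Oc1].
    + by move=> c c' cc' [Oc O'c]; split; [exact: oO Oc|exact: oO' O'c].
    + move=> c [Oc O'c] [sub e]; split; [apply: OP|apply: OQ] => //.
        by split=> w wu; [apply: sub|apply: e]; rewrite mem_cat wu.
      by split=> w wu; [apply: sub|apply: e]; rewrite mem_cat wu orbT.
  - by move=> P Q PQ [u [O [dO oO OP]]]; exists u, O; split=> // c Oc uc; exact/PQ/OP.
have [G [GU FG]] := ultraFilterLemma FF.
have Gopn O : dense O -> opn O -> G O.
  by move=> dO oO; apply: FG; exists [::], O.
have Gdec A y : G [set c | decided D A (shift c y)].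
  apply: Gopn => [c|c c' cc']; last exact/ext_decided/ext_shift.
  have [c' cc' dec] := decD A (shift c y).
  exists (shift c' y); last by rewrite /= shiftK.
  by rewrite -(shiftK c y); exact: ext_shift.
pose Phi A : set (T -> nat) := [set y | G [set c | incl D (shift c y) A]].
have PhiI A B : Phi (A `&` B) = Phi A `&` Phi B.
  apply/seteqP; split=> y.
    move=> GAB; split; apply: filterS GAB => c; rewrite /incl; apply: filterS => i [?|[]];
      by [left|right].
  by move=> [GA GB]; apply: filterS (filterI GA GB) => c [cA cB]; exact: inclI.
have Phi0 : Phi set0 = set0.
  rewrite -subset0 => y Gy; apply: (@filter_not_empty _ G _).
  by apply: filterS Gy => c /incl0.
have PhiC A : Phi (~` A) = ~` Phi A.
  apply/seteqP; split=> y.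
    move=> GnA GA; have : (Phi (~` A) `&` Phi A) y by [].
    by rewrite -PhiI setICl Phi0.
  move=> nGA; have [//|GnA] := in_ultra_setVsetC [set c | incl D (shift c y) (~` A)] GU.
  case: nGA; apply: filterS (filterI GnA (Gdec A y)) => c [nA [//|]].
  by move/nA.
have PhiS A B : A `<=` B -> Phi A `<=` Phi B.
  by move=> /setIidl AB y; rewrite -{1}AB PhiI => -[].
have Phiw w y : Phi [set i | f w i = y w] y.
  apply: FG; exists [:: w], setT; split=> // [c|c _ [sub e]].
    by exists c => //; exact: ext_refl.
  rewrite /= /incl (_ : _ `|` _ = setT); first exact: filterT.
  apply/seteqP; split=> // i _; have [ic|nic] := pselect (cyl (shift c y) i); last by left.
  right; rewrite /= ic /=; last by apply: sub; rewrite mem_head.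
  by rewrite e ?mem_head //= /swap0 eqxx.
exists Phi; split=> //.
- move=> A DA; apply/seteqP; split=> // y _; apply: (@filterS _ G _ setT); last exact: filterT.
  by move=> c _; rewrite /= /incl; apply: filterS DA => i; right.
- move=> w n; apply/seteqP; split=> y /= yn; last by rewrite -yn; exact: Phiw.
  apply: contrapT => ynn; have : (Phi [set i | f w i = n] `&` Phi [set i | f w i = y w]) y by [].
  rewrite -PhiI (_ : _ `&` _ = set0) ?Phi0 // -subset0 => i [/= -> E]; exact: ynn.
- move=> A; have [S cS SP] := decision_support A; exists S => // y y' yy' Ay.
  have GS : G [set c | decided D A (restr S (shift c y))].
    apply: Gopn => [c|c c' cc'].
      have [c' cc' dec] := SP (shift c y); exists (shift c' y); last by rewrite /= shiftK.
      by rewrite -(shiftK c y); exact: ext_shift.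
    apply: ext_decided; have [sub e] := ext_shift y cc'.
    split=> [w /mem_restr[wc Sw]|w /mem_restr[wc Sw]]; last exact: e.
    by apply/mem_restr; split=> //; exact: sub.
  apply: filterS (filterI Ay GS) => c [cA dec].
  (* The restriction cannot decide against [A], as the full condition forces [A]. It is also a
     restriction of the translate by [y'], which agrees with [y] on [S]. *)
  have {dec} rA : incl D (restr S (shift c y)) A.
    case: dec => // /(ext_incl (ext_restr _ _)) cnA.
    by case: (@incl0 (shift c y)); rewrite -(setICr A); exact: inclI.
  apply: (@ext_incl (restr S (shift c y))) rA.
  split=> [w /mem_restr[]//|w /mem_restr[_ Sw]] /=.
  by rewrite yy'.
Qed.

End Cylinders.

(** * Iterated products of ultrafilters *)

(** A form of being an ultrafilter that passes through products and limits by rewriting. *)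
Definition boolean_set_system X (F : set_system X) :=
  (forall A B, F (A `&` B) <-> F A /\ F B) /\ (forall A, F (~` A) <-> ~ F A).

Lemma ultra_boolean X (F : set_system X) : UltraFilter F -> boolean_set_system F.
Proof.
move=> FU; split=> [A B|A].
  split=> [FAB|[FA FB]]; last exact: filterI.
  by split; apply: filterS FAB => x [].
split=> [FnA FA|nFA]; last by case: (in_ultra_setVsetC A FU).
apply: (@filter_not_empty _ F _); rewrite -(setICl A); exact: filterI.
Qed.

Section Boolean.
Variables (X : Type) (F : set_system X).
Hypothesis Fb : boolean_set_system F.

Lemma booleanS A B : A `<=` B -> F A -> F B.
Proof. by move=> /setIidl <- /(proj1 Fb)[]. Qed.

Lemma booleanI A B : F A -> F B -> F (A `&` B).
Proof. by move=> FA FB; apply/(proj1 Fb). Qed.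

Lemma boolean0 : ~ F set0.
Proof.
move=> F0; have : F (~` set0) by apply: booleanS F0.
by move/(proj2 Fb).
Qed.

Lemma booleanT : F setT.
Proof. by rewrite -setC0; apply/(proj2 Fb)/boolean0. Qed.

Lemma boolean_ex A : F A -> A !=set0.
Proof. by move=> FA; apply/set0P/eqP => A0; apply: boolean0; rewrite -A0. Qed.

Lemma boolean_const (P : Prop) : F [set _ | P] <-> P.
Proof.
split=> [/boolean_ex[]//|p]; apply: booleanS booleanT => x _; exact: p.
Qed.

Lemma boolean_ultra : UltraFilter F.
Proof.
have FF : ProperFilter F.
  apply: Build_ProperFilter_ex; first exact: boolean_ex.
  split; [exact: booleanT|exact: booleanI|exact: booleanS].
split=> // G GF FG; apply/seteqP; split=> // A GA.
apply: contrapT => /(proj2 Fb)/FG GnA.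
by apply: (@filter_not_empty _ G _); rewrite -(setICr A); exact: filterI.
Qed.

End Boolean.

Lemma nonprincipal_ultrafilter :
  exists2 E : set_system nat, boolean_set_system E & forall n, E [set m | (n < m)%N].
Proof.
have [E [EU oE]] := ultraFilterLemma eventually_filter.
by exists E; [exact: ultra_boolean|move=> n; apply: oE; exists n.+1].
Qed.

Section Iteration.
Variables (T : eqType) (lt : T -> T -> Prop).
Hypothesis ltP : strict_well_order lt.

Local Notation "x ≺ y" := (lt x y) (at level 70, no associativity).
Local Notation "x ≼ y" := (x ≺ y \/ x = y) (at level 70, no associativity).

Let irr x : ~ x ≺ x := wo_irrefl ltP (x:=x).
Let tr y x z : x ≺ y -> y ≺ z -> x ≺ z := swo_trans ltP (y:=y) (x:=x) (z:=z).
Let letr y x z : x ≼ y -> y ≺ z -> x ≺ z := wo_le_lt_trans ltP (y:=y) (x:=x) (z:=z).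

Lemma tail_ultrafilters : exists U : set T -> set_system T, forall L, L !=set0 ->
  boolean_set_system (U L) /\ forall x, L x -> U L [set y | L y /\ x ≼ y].
Proof.
suff /choice[U UP] : forall L : set T, exists U : set_system T, L !=set0 ->
    boolean_set_system U /\ forall x, L x -> U [set y | L y /\ x ≼ y].
  by exists U.
move=> L; have [[x0 Lx0]|L0] := pselect (L !=set0); last by exists setT.
pose F : set_system T := [set A | exists2 x, L x & [set y | L y /\ x ≼ y] `<=` A].
have FF : ProperFilter F.
  apply: Build_ProperFilter_ex.
    by move=> A [x Lx xA]; exists x; apply: xA; split=> //; right.
  split.
  - by exists x0.
  - move=> A B [x Lx xA] [y Ly yB].
    have [xy|xy|yx] := swo_total ltP x y.
    + exists y => // z [Lz yz]; split; [apply: xA|exact: yB].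
      by split=> //; left; exact: wo_lt_le_trans yz.
    + by exists y => // z [Lz yz]; split; [apply: xA; rewrite xy|exact: yB].
    + exists x => // z [Lz xz]; split; [exact: xA|apply: yB].
      by split=> //; left; exact: wo_lt_le_trans xz.
  - by move=> A B AB [x Lx xA]; exists x => //; exact: subset_trans AB.
have [G [GU FG]] := ultraFilterLemma FF.
exists G => _; split; first exact: ultra_boolean.
by move=> x Lx; apply: FG; exists x.
Qed.

Variables (E : set_system nat) (U : set T -> set_system T).
Hypothesis Eb : boolean_set_system E.
Hypothesis E_gt : forall n, E [set m | (n < m)%N].
Hypothesis UP : forall L, L !=set0 ->
  boolean_set_system (U L) /\ forall x, L x -> U L [set y | L y /\ x ≼ y].

Local Notation K := (T -> nat).
Implicit Types (A B : set K) (L S : set T) (y : K).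

Definition upd y x n : K := fun w => if w == x then n else y w.

Definition below x : set T := [set z | z ≺ x].

(** When [L] has a greatest element, the tail condition makes [U L] principal there, so successor
    and limit stages share one formula. The empty stage is principal at the zero function. *)
Definition limit_along (V : T -> set_system K) L : set_system K :=
  [set A | if pselect (L !=set0) then U L [set x | L x /\ V x A] else A (fun=> 0%N)].

(* iter x is the iterated Fubini product of copies of E over the coordinates z ≼ x,
   later coordinates being quantified first; at limits it is the limit along U. *)
Definition iter : T -> set_system K :=
  Fix (swo_wf ltP) (fun=> set_system K) (fun x rec =>
    [set A | E [set n | limit_along
       (fun z => if pselect (z ≺ x) is left zx then rec z zx else set0)
       (below x) [set y | A (upd y x n)]]]).

Definition Iter L : set_system K := limit_along iter L.

Lemma eq_limit_along V V' L : (forall x, L x -> V x = V' x) ->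
  limit_along V L = limit_along V' L.
Proof.
move=> VV'; apply/predeqP => A; rewrite /limit_along /=; case: pselect => // L0.
rewrite (_ : [set x | L x /\ V x A] = [set x | L x /\ V' x A]) //.
by apply/seteqP; split=> x /= [Lx VA]; split=> //; move: VA; rewrite VV'.
Qed.

Lemma iterE x : iter x = [set A | E [set n | Iter (below x) [set y | A (upd y x n)]]].
Proof.
rewrite /iter Fix_eq => [|z r r' rr']; last first.
  suff -> : r = r' by [].
  by do 2 apply: functional_extensionality_dep => ?; exact: rr'.
rewrite (@eq_limit_along _ iter) // => z zx; by case: pselect.
Qed.

Lemma boolean_limit_along V L : (forall x, L x -> boolean_set_system (V x)) ->
  boolean_set_system (limit_along V L).
Proof.
move=> Vb; have [L0|nL0] := pselect (L !=set0); last first.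
  by rewrite /limit_along; split=> [A B|A] /=; case: pselect.
have [LE|] := pselect (limit_along V L = [set A | U L [set x | L x /\ V x A]]); last first.
  by case; apply/predeqP => A; rewrite /limit_along /=; case: pselect.
rewrite LE.
have [UL Ut] := UP L0.
have UL1 : U L L by have [x Lx] := L0; apply: booleanS (Ut x Lx) => // z [].
split=> [A B|A] /=.
  rewrite -(proj1 UL); set P := (X in U L X); set Q := (X in _ <-> U L X).
  suff -> : P = Q by [].
  apply/seteqP; split=> x; rewrite /P /Q /=.
    by move=> [Lx /(proj1 (Vb x Lx))[]].
  by move=> [[Lx VA] [_ VB]]; split=> //; apply/(proj1 (Vb x Lx)).
rewrite -(proj2 UL); split=> H.
  by apply: booleanS H => // x [Lx /(proj2 (Vb x Lx)) nVA] [].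
apply: booleanS (booleanI UL UL1 H) => // x [Lx nVA]; split=> //.
by apply/(proj2 (Vb x Lx)) => VA; apply: nVA.
Qed.

Lemma boolean_iter x : boolean_set_system (iter x).
Proof.
elim/(well_founded_ind (swo_wf ltP)): x => x IH.
have Ib : boolean_set_system (Iter (below x)) by apply: boolean_limit_along => z /IH.
rewrite iterE; split=> [A B|A] /=.
  rewrite -(proj1 Eb); set P := (X in E X); set Q := (X in _ <-> E X).
  suff -> : P = Q by [].
  by apply/seteqP; split=> n; rewrite /P /Q /= -(proj1 Ib).
rewrite -(proj2 Eb); set P := (X in E X); set Q := (X in _ <-> E X).
suff -> : P = Q by [].
by apply/seteqP; split=> n; rewrite /P /Q /= -(proj2 Ib).
Qed.

Lemma boolean_Iter L : boolean_set_system (Iter L).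
Proof. by apply: boolean_limit_along => x _; exact: boolean_iter. Qed.

Lemma Iter_ex L x A : L x -> Iter L A -> exists z, [/\ L z, x ≼ z & iter z A].
Proof.
move=> Lx; rewrite /Iter /limit_along /=; case: pselect => [L0|nL0]; last by case: nL0; exists x.
have [UL Ut] := UP L0; move=> /(booleanI UL (Ut x Lx))/(boolean_ex UL)[z [[Lz xz] [_ zA]]].
by exists z.
Qed.

Lemma Iter_tail L x A (P : Prop) : L x ->
  (forall z, L z -> x ≼ z -> (iter z A <-> P)) -> (Iter L A <-> P).
Proof.
move=> Lx AP; split=> [/(Iter_ex Lx)[z [Lz xz]]|p]; first by move/(AP _ Lz xz).
apply: contrapT => /(proj2 (boolean_Iter L))/(Iter_ex Lx)[z [Lz xz]].
by move/(proj2 (boolean_iter z)); apply; apply/(AP _ Lz xz).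
Qed.

Definition supported S A := forall y y', (forall w, S w -> y w = y' w) -> A y -> A y'.

Lemma updE y x n : upd y x n x = n.
Proof. by rewrite /upd eqxx. Qed.

Lemma upd_neq y x n w : w <> x -> upd y x n w = y w.
Proof. by rewrite /upd; case: eqP. Qed.

Lemma supported_upd S A x n : supported S A -> supported S [set y | A (upd y x n)].
Proof.
by move=> SA y y' yy'; apply: SA => w Sw; rewrite /upd; case: ifP => // _; exact: yy'.
Qed.

Lemma upd_supported S A x n : supported S A -> ~ S x -> [set y | A (upd y x n)] = A.
Proof.
move=> SA Sx; apply/seteqP; split=> y; apply: SA => w Sw; rewrite upd_neq // => wx;
  by rewrite wx in Sw.
Qed.

Lemma iter_unsupported S A x : supported S A -> ~ S x -> iter x A <-> Iter (below x) A.
Proof.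
move=> SA Sx; rewrite iterE /=; under eq_set do rewrite (upd_supported _ SA Sx).
exact: boolean_const.
Qed.

(** Quantifiers over the coordinates in $(x, z]$ are vacuous, as [S] misses them. *)
Lemma iter_agree S A x z : supported S A -> x ≼ z ->
  (forall w, S w -> w ≼ z -> ~ x ≺ w) -> iter z A <-> iter x A.
Proof.
move=> SA; elim/(well_founded_ind (swo_wf ltP)): z => z IH [xz|<- //] Sz.
rewrite (iter_unsupported SA); last by move=> /Sz; apply=> //; right.
apply: (Iter_tail xz) => t tz xt; apply: IH => // w Sw wt; apply: Sz => //.
by left; exact: (letr wt tz).
Qed.

Lemma Iter_agree S A L x : supported S A -> L x -> (forall u v, L u -> v ≺ u -> L v) ->
  (forall w, S w -> L w -> ~ x ≺ w) -> Iter L A <-> iter x A.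
Proof.
move=> SA Lx Ll Sx; apply: (Iter_tail Lx) => z Lz xz; apply: (iter_agree SA) => // w Sw wz.
by apply: Sx => //; case: wz => [/(Ll _ _ Lz)|->].
Qed.

(** Fix witnesses from [z] downwards until stage [x] is reached; the values so chosen depend on no
    earlier coordinate, hence work for all points of [A']. *)
Lemma iter_descend A x z : x ≼ z -> iter z A ->
  exists2 A', iter x A' & forall y, A' y ->
    exists2 y', A y' & forall w, ~ (x ≺ w /\ w ≼ z) -> y' w = y w.
Proof.
elim/(well_founded_ind (swo_wf ltP)): z A => z IH A [xz|<-] zA; last first.
  by exists A => // y Ay; exists y.
move: zA; rewrite iterE => /(boolean_ex Eb)[n /(Iter_ex xz)[t [tz xt /(IH _ tz _ xt)]]].
move=> [A' xA' A'P]; exists A' => // y /A'P[y' Ay' y'y]; exists (upd y' z n) => // w nw.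
rewrite upd_neq => [|wz]; last by apply: nw; rewrite wz; split=> //; right.
by apply: y'y => -[xw wt]; apply: nw; split=> //; left; exact: (letr wt tz).
Qed.

(* The coordinates above b are chosen commonly for A and A'; those strictly between
   a and b then matter for A only, so they are chosen first, and the values at b
   (for A') and at a (for A) are finally drawn from the same member of E. *)
Lemma iter_amalgam S S' A A' a b z : a ≺ b -> b ≼ z ->
  supported S A -> supported S' A' -> ~ S b ->
  (forall w, S' w -> w ≺ b -> w ≺ a) ->
  iter z A -> iter z A' -> exists y, [/\ A y, A' y & y a = y b].
Proof.
move=> ab; elim/(well_founded_ind (swo_wf ltP)): z A A' => z IH A A' bz SA SA' Sb S'b zA zA'.
case: bz => [bz|zE].
  move: zA zA'; rewrite !iterE => zA /(booleanI Eb zA)/(boolean_ex Eb)[n].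
  move=> [zAn /(booleanI (boolean_Iter _) zAn)/(Iter_ex bz)[t [tz bt]]].
  move=> /(proj1 (boolean_iter t))[tA tA'].
  have [||y [Ay A'y yab]] := IH t tz _ _ bt _ _ Sb S'b tA tA'; try exact: supported_upd.
  have neq w : w ≺ z -> w <> z by move=> wz wE; rewrite wE in wz; exact: irr wz.
  exists (upd y z n); split=> //; rewrite !upd_neq //; apply: neq => //.
  exact: tr bz.
rewrite -{}zE in IH zA zA'.
(* Stage [b] is vacuous for [A], which is therefore large at some stage in $[a, b)$. *)
have [t [tb ta tA]] : exists t, [/\ t ≺ b, a ≼ t & iter t A].
  by move/(iter_unsupported SA Sb): zA => /(Iter_ex ab)[t [? ? ?]]; exists t.
have [A1 aA1 A1P] := iter_descend ta tA.
(* With the value at [b] fixed, [A'] depends on no coordinate in $[a, b)$. *)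
have bA' n : Iter (below b) [set y | A' (upd y b n)] -> Iter (below a) [set y | A' (upd y b n)].
  have SA'n := @supported_upd _ _ b n SA'.
  have S'a : ~ S' a by move=> /S'b -/(_ ab)/irr.
  have aE := iter_unsupported SA'n S'a.
  suff bE : Iter (below b) [set y | A' (upd y b n)] <-> iter a [set y | A' (upd y b n)].
    by move=> /bE/aE.
  apply: (Iter_tail ab) => u ub au; apply: (iter_agree SA'n) => // w Sw wu aw.
  exact: irr (tr aw (S'b w Sw (letr wu ub))).
(* Both sets of admissible values lie in [E]: a common [n] is used at [a] for [A1] and at [b] for
   [A']. *)
move: aA1 zA'; rewrite !iterE => aA1 /(booleanI Eb aA1)/(boolean_ex Eb)[n].
move=> [An /bA' /(booleanI (boolean_Iter _) An)/(boolean_ex (boolean_Iter _))[y]].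
move=> [/A1P[y' Ay' y'y] A'y].
exists (upd y' b n); rewrite updE; split.
- by move: Ay'; rewrite -[A in A y'](upd_supported n SA Sb).
- apply: SA' A'y => w S'w; have [->|wb] := eqVneq w b; first by rewrite !updE.
  rewrite !upd_neq; try exact/eqP.
  rewrite y'y; last by move=> [aw wt]; apply: irr (tr aw (S'b w S'w _));
    exact: letr tb.
  rewrite upd_neq // => wa; rewrite wa in S'w; exact: irr (S'b _ S'w ab).
- rewrite upd_neq; last by move=> aE; rewrite aE in ab; exact: irr ab.
  by rewrite y'y ?updE // => -[/irr].
Qed.

Lemma Iter_amalgam L S S' A A' a b : a ≺ b -> L b ->
  supported S A -> supported S' A' -> ~ S b ->
  (forall w, S' w -> w ≺ b -> w ≺ a) ->
  Iter L A -> Iter L A' -> exists y, [/\ A y, A' y & y a = y b].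
Proof.
move=> ab Lb SA SA' Sb S'b IA IA'.
have [z [Lz bz]] := Iter_ex Lb (booleanI (boolean_Iter L) IA IA').
move=> /(proj1 (boolean_iter z))[zA zA']; exact: (iter_amalgam ab bz SA SA' Sb S'b zA zA').
Qed.

Lemma Iter_coord L' a (P : set nat) : L' a -> (forall u v, L' u -> v ≺ u -> L' v) ->
  Iter L' [set y | P (y a)] <-> E P.
Proof.
move=> La L'l.
have Sa : supported [set a] [set y | P (y a)] by move=> y y' /= ->.
rewrite (Iter_agree Sa La L'l); last by move=> w -> _; exact: irr.
rewrite iterE /=; suff -> : [set n | Iter (below a) [set y | P (upd y a n a)]] = P by [].
apply/predeqP => n /=; under eq_set do rewrite updE; exact: boolean_const (boolean_Iter _) _.
Qed.

Lemma E_neq n : E [set m | m <> n].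
Proof. by apply: booleanS (E_gt n) => // m nm mn; rewrite /= mn ltnn in nm. Qed.

Section LowerSet.
Variable L : set T.
Hypothesis Ll : forall u v, L u -> v ≺ u -> L v.

(** The value at [b] is fixed first, and then [E]-almost every value at [a] avoids it. *)
Lemma Iter_distinct a b : a ≺ b -> L b -> Iter L [set y | y a <> y b].
Proof.
move=> ab Lb.
have Sab : supported [set w | w = a \/ w = b] [set y | y a <> y b].
  by move=> y y' yy' /=; rewrite !yy'; by [|right|left].
rewrite (Iter_agree Sab Lb Ll); last first.
  by move=> w [->|->] _; [move=> /(tr ab)|]; exact: irr.
rewrite iterE /=; apply: booleanS (booleanT Eb) => // n _ /=.
apply: (@booleanS _ _ (boolean_Iter _) [set y | y a <> n]).
  move=> y yn /=; rewrite updE upd_neq // => aE; rewrite aE in ab; exact: irr ab.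
apply/(@Iter_coord _ _ [set m | m <> n] ab); last exact: E_neq.
by move=> y z yb zy; exact: tr yb.
Qed.

(** The value [n] at [x] is fixed before the coordinates on which [Q] depends, so only the largeness
    of each single [Q n] is needed. This places coordinate [x] below every nonstandard number with
    earlier support. *)
Lemma Iter_diagonal S x (Q : nat -> set K) : L x ->
  (forall n, supported S (Q n)) -> (forall w, S w -> L w -> w ≺ x) ->
  (forall n, Iter L (Q n)) -> Iter L [set y | Q (y x) y].
Proof.
move=> Lx SQ Sx IQ.
have SQx : supported (x |` S) [set y | Q (y x) y].
  move=> y y' yy' /=; rewrite -(yy' x); last by left.
  by apply: SQ => w Sw; apply: yy'; right.
have nSx : ~ S x by move=> /Sx /(_ Lx); exact: irr.
apply/(Iter_agree SQx Lx Ll).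
  move=> w [->|Sw] Lw; first exact: irr.
  by move=> xw; apply: irr (tr xw (Sx w Sw Lw)).
rewrite iterE /=; apply: booleanS (booleanT Eb) => // n _ /=; under eq_set do rewrite updE.
rewrite (upd_supported _ (SQ n) nSx); apply/(iter_unsupported (SQ n) nSx).
apply/(Iter_agree (SQ n) Lx Ll) => // w Sw Lw xw.
by apply: irr (tr xw (Sx w Sw Lw)).
Qed.

End LowerSet.
End Iteration.

(** * Ultrapowers *)

Section UltrapowerReps.
Variables (I : Type) (D : set_system I) (L : language) (M : structure L).
Hypothesis FD : Filter D.

Lemma uclass_refl (f : I -> M) : uclass D f f.
Proof. by apply: filterS filterT => i _. Qed.

Lemma uclass_urepr (x : ultrapower D M) : uclass D (urepr x) = sval x.
Proof. by rewrite /urepr; case: (cid _). Qed.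

Lemma urepr_upi (f : I -> M) : D [set i | f i = urepr (upi D f) i].
Proof. by have := uclass_refl (urepr (upi D f)); rewrite uclass_urepr. Qed.

End UltrapowerReps.

(** * Nonstandard numbers and the lower cofinality *)

Section LowerCofinality.
Variables (I : Type) (D : set_system I).
Hypothesis PD : ProperFilter D.
Let FD : Filter D := filter_filter (ProperFilter := PD).

Definition nonstandard (h : I -> nat) := forall n, D [set i | (n < h i)%N].

Lemma above_omegaE (x : ultrapower D omega) : above_omega x <-> nonstandard (urepr x).
Proof.
have diagE n : D [set i | n = urepr (diag D (n : omega)) i].
  exact: (urepr_upi FD (fun=> n : omega)).
split=> H n; have Hn := H n; have dn := diagE n.
  apply: filterS (filterI Hn dn) => i [/= nx nE].
  by apply: leq_ltn_trans nx; apply: eq_leq; exact: nE.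
rewrite /rel_of /=; apply: filterS (filterI Hn dn) => i [/= nx nE].
by apply: leq_ltn_trans nx; apply: eq_leq; exact: esym nE.
Qed.

(** A coinitial set of least size exists by [least_card]. If it embedded in [I], its members would
    have a common strict nonstandard lower bound, against coinitiality. *)
Lemma large_lcf (h0 : I -> nat) (I1 : Type) : is_succ_card I I1 -> nonstandard h0 ->
  (forall g : I -> I -> nat, (forall j, nonstandard (g j)) ->
    exists2 h, nonstandard h & forall j, D [set i | (h i < g j i)%N]) ->
  exists kappa : Type, is_lcf D kappa /\ [set: I1] #<= [set: kappa].
Proof.
move=> [_ I1min] h0ns lb.
pose J := {C | @coinitial_in I D (@above_omega I D) C}.
have [] := @least_card J (fun C => set_type (sval C)).
  exists (@above_omega I D); split=> // x ax; exists x => //; by left.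
move=> [C coC] Cmin; exists (set_type C).
have lcfC : is_lcf D C.
  split; first by exists C; split=> //; exact: card_setT_sym.
  move=> C' coC'; have := Cmin (exist _ C' coC').
  by rewrite /= (card_le_eqr (card_setT C')).
split=> //; apply: I1min.
suff nCI : ~ ([set: C] #<= [set: I]).
  by split=> //; have [|/nCI] := card_le_total [set: I] [set: C].
rewrite (card_le_eql (card_setT C)) => CI.
have [i0] : exists i0 : I, True.
  have [i0 _] := filter_ex (filterT : D setT); by exists i0.
move=> _; have [e [_ einj]] := card_leE i0 CI.
have [Cab Cco] := coC.
(* Indices that code no member of [C] receive the dummy [h0]. *)
have /choice[g gP] : forall j, exists g : I -> nat,
    nonstandard g /\ forall x, C x -> e x = j -> g = urepr x.
  move=> j; have [[x [Cx <-]]|nx] := pselect (exists x, C x /\ e x = j).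
    exists (urepr x); split; first exact/above_omegaE/Cab.
    by move=> x' Cx' /einj->.
  by exists h0; split=> // x Cx xj; case: nx; exists x.
have [h hns hlb] := lb g (fun j => proj1 (gP j)).
have hE := urepr_upi FD (M := omega) h.
have [|y Cy yh] := Cco (upi D (h : I -> omega)).
  by apply/above_omegaE => n; apply: filterS (filterI (hns n) hE) => i [] /= + <-.
have := hlb (e y); rewrite (proj2 (gP (e y)) y Cy erefl) => hy.
case: yh => [yE|yh].
  rewrite yE in hy; have [i [/=]] := filter_ex (filterI hy hE).
  by move=> + hi; rewrite -hi ltnn.
have [i [[/= hyi yhi] hi]] := filter_ex (filterI (filterI hy yh) hE).
by move: yhi; rewrite /pair_fun /= -hi => /(ltn_trans hyi); rewrite ltnn.
Qed.

End LowerCofinality.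

Section Satisfaction.
Variables (L : language) (M : structure L).
Implicit Types (v : nat -> M) (p q : formula L).

Lemma sat_FAnd v p q : sat v (FAnd p q) <-> sat v p /\ sat v q.
Proof.
split=> [/= pq|[sp sq] /= pq]; last exact: pq.
by split; apply: contrapT => n; apply: pq.
Qed.

Lemma sat_FEx v n p : sat v (FEx n p) <-> exists a, sat (update v n a) p.
Proof.
split=> [/= ex|[a pa] /= all]; last exact: all pa.
by apply: contrapT => n0; apply: ex => a pa; apply: n0; exists a.
Qed.

Lemma sat_FConj_cat v s t : sat v (FConj (s ++ t)) <-> sat v (FConj s) /\ sat v (FConj t).
Proof.
elim: s => [|p s IH]; first by split=> [|[]] //=; split.
rewrite /= -/(FConj (s ++ t)) -/(FConj s).
have := sat_FAnd v p (FConj (s ++ t)); have := sat_FAnd v p (FConj s); rewrite /FAnd /=.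
tauto.
Qed.

Lemma sat_FConj_map (U : eqType) v (F : U -> formula L) (s : seq U) :
  sat v (FConj [seq F i | i <- s]) <-> forall i, i \in s -> sat v (F i).
Proof.
elim: s => [|i s IH]; first by split=> // _ [].
rewrite map_cons -cat1s sat_FConj_cat IH; split.
  move=> [/sat_FAnd[Fi _] Fs] j; rewrite inE => /orP[/eqP->//|]; exact: Fs.
move=> Fs; split; last by move=> j js; apply: Fs; rewrite inE js orbT.
by apply/sat_FAnd; split; [apply: Fs; rewrite mem_head|case].
Qed.

Lemma sat_FConj_allpairs (U V : eqType) v (F : U -> V -> formula L) (s : seq U) (t : seq V) :
  sat v (FConj [seq F i j | i <- s, j <- t]) <->
  forall i j, i \in s -> j \in t -> sat v (F i j).
Proof.
elim: s => [|i s IH]; first by split=> // _ [].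
rewrite allpairs_cons sat_FConj_cat IH sat_FConj_map; split.
  by move=> [Fi Fs] k j; rewrite inE => /orP[/eqP->|]; [exact: Fi|exact: Fs].
by move=> Fs; split=> [j jt|k j ks jt]; apply: Fs; rewrite // inE ?eqxx ?ks ?orbT.
Qed.

Lemma sat_FAlls s v p : (forall v', sat v' p) -> sat v (FAlls s p).
Proof. by move=> pT; elim: s v => //= k s IH v a; exact: IH. Qed.

End Satisfaction.

(** A code contains a finite list and a padding number, which gives each list arbitrarily large
    codes. *)
Definition listed (k : nat) : seq nat :=
  if (choice.unpickle k : option (nat * seq nat)) is Some p then p.2 else [::].

(* Each finite set of vertices is the set of smaller neighbours of infinitely
   many vertices. *)
Definition rg_edge (m n : nat) : Prop :=
  (m < n)%N && (m \in listed n) \/ (n < m)%N && (n \in listed m).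

Lemma rg_edge_ext (xs ys : seq nat) : (forall x, x \in xs -> x \notin ys) ->
  exists z, (forall x, x \in xs -> rg_edge z x) /\
    forall y, y \in ys -> z <> y /\ ~ rg_edge z y.
Proof.
move=> dis.
have [N HN] : exists N, forall x, x \in xs ++ ys -> (x <= N)%N.
  elim: (xs ++ ys) => [|x s [N HN]]; first by exists 0%N.
  exists (maxn x N) => y; rewrite inE => /orP[/eqP->|/HN yN]; first exact: leq_maxl.
  by rewrite (leq_trans yN) // leq_maxr.
(* Beyond all given vertices, adjacency to them is governed by the list coded in [z] alone. *)
have [k Nk] := @injective_gtn (fun k => choice.pickle (k, xs))
  (fun k k' E => congr1 fst (pcan_inj choice.pickleK E)) N.
set z := choice.pickle (k, xs) in Nk.
have zE : listed z = xs by rewrite /listed /z choice.pickleK.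
exists z; split=> [x xxs|y yys].
  right; rewrite zE xxs andbT (leq_ltn_trans _ Nk) // HN // mem_cat xxs //.
have yz : (y < z)%N by rewrite (leq_ltn_trans _ Nk) // HN // mem_cat yys orbT.
split=> [zy|[/andP[zy _]|/andP[_]]]; first by rewrite -zy ltnn in yz.
  by have := ltn_trans yz zy; rewrite ltnn.
by rewrite zE => /dis; rewrite yys.
Qed.

Definition random_graph : structure binary_language :=
  binary_structure (inhabits 0%N) rg_edge.

Lemma models_random_graph : models random_graph random_graph_theory.
Proof.
move=> p [->|[->|[n [m ->]]]] v.
- by move=> a /= [] /andP[]; rewrite /pair_fun /update /= ltnn.
- by move=> a b /= [] ab; [right|left].
apply: sat_FAlls => {}v.
set ex := FEx _ _.
suff : (forall i j, i \in iota 1 n -> j \in iota n.+1 m -> v i <> v j) -> sat v ex.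
  by move=> exP /sat_FConj_allpairs.
move=> dis; apply/sat_FEx.
have [|z [zx zy]] := @rg_edge_ext (map v (iota 1 n)) (map v (iota n.+1 m)).
  move=> _ /mapP[i iI ->]; apply/negP => /mapP[j jJ vij].
  exact: (dis i j iI jJ vij).
exists z; apply/sat_FAnd; split; apply/sat_FConj_map => i iI.
  have i0 : (i == 0%N) = false by move: iI; rewrite mem_iota; case: i.
  by have := zx _ (map_f v iI); rewrite /= /pair_fun /update /= i0.
have i0 : (i == 0%N) = false by move: iI; rewrite mem_iota; case: i.
have [zi nzi] := zy _ (map_f v iI).
by apply/sat_FAnd; rewrite /= /pair_fun /update /= i0.
Qed.

Lemma filter_forall_seq I (F : set_system I) (U : eqType) (s : seq U) (P : U -> set I) :
  Filter F -> (forall x, x \in s -> F (P x)) -> F [set i | forall x, x \in s -> P x i].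
Proof.
move=> FF; elim: s => [|x s IH] FP; first by apply: filterS filterT.
have Fs : F [set i | forall x, x \in s -> P x i].
  by apply: IH => y ys; apply: FP; rewrite inE ys orbT.
apply: filterS (filterI (FP x (mem_head _ _)) Fs) => i [Px Ps] y.
by rewrite inE => /orP[/eqP->//|]; exact: Ps.
Qed.

Section Saturation.
Variables (I : Type) (D : set_system I) (K : Type) (T : eqType) (Theta : set T).
Variables (f : T -> I -> nat) (t : T -> Prop).
Hypothesis UD : UltraFilter D.
Let FD : Filter D := filter_filter (ProperFilter := ultra_proper (UltraFilter := UD)).
Hypothesis ThetaK : card_lt Theta [set: K].
Hypothesis f_neq : forall w w', Theta w -> Theta w' -> w <> w' -> D [set i | f w i <> f w' i].

Local Notation N := (ultrapower D random_graph).

(** The prescribed adjacencies form a type: at almost every index finitely many of the [f w] have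
    distinct values, and the extension property of the graph supplies a vertex there. *)
Lemma saturated_random_graph : saturated K N ->
  exists x : I -> nat, forall w, Theta w ->
    (t w -> D [set i | rg_edge (x i) (f w i)]) /\
    (~ t w -> D [set i | ~ rg_edge (x i) (f w i)]).
Proof.
move=> satN.
pose a w : N := upi D (f w : I -> random_graph).
pose A : set N := a @` Theta.
have aE w : D [set i | f w i = urepr (a w) i] := urepr_upi FD (f w : I -> random_graph).
pose L := add_constants binary_language {a : N | A a}.
pose atom (c : {a : N | A a}) : formula L :=
  @FRel L tt (pair_fun (@Var L 0%N) (@App L (inr c) (fun i => False_rect _ (notF (ltn_ord i))))).
have sat_atom (x : N) c : @sat _ (with_params A) (fun=> x) (atom c) <->
    D [set i | rg_edge (urepr x i) (urepr (sval c) i)] by [].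
pose lit (w : T) c := if pselect (t w) then atom c else FNot (atom c).
pose G : set (formula L) := [set p | exists w, Theta w /\ exists c, sval c = a w /\ p = lit w c].
have AK : card_lt A [set: K].
  case: ThetaK => TK nKT; split; first exact: card_le_trans (card_image_le _ _) TK.
  by move=> KA; apply: nKT; exact: card_le_trans KA (card_image_le _ _).
have typeG : is_type G.
  split=> [p [w [_ [c [_ ->]]]]|H finH HG].
    have fvA : fv (atom c) `<=` [set 0%N].
      move=> n [i]; rewrite /pair_fun; case: ifP => _ //= [j].
      by have := ltn_ord j.
    by rewrite /lit; case: pselect => _ // n [/fvA|].
  have [[w0 _]|T0] := pselect (Theta !=set0); last first.
    by exists (upi D (fun=> 0%N : random_graph)) => p /HG[w [Tw _]]; case: T0; exists w.
  have /choice[W WP] : forall p, exists w, G p -> Theta w /\ exists c, sval c = a w /\ p = lit w c.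
    by move=> p; have [[w wP]|nG] := pselect (G p); [exists w|exists w0].
  have /finite_seqP[u uE] := finite_image W finH.
  have uT w : w \in u -> Theta w.
    move=> wu; have : (W @` H) w by rewrite uE.
    by move=> [p /HG/WP[TW _] <-].
  (* Indices where two of the values coincide get the vertex 0; they form a null set. *)
  have /choice[z zP] : forall i, exists z, (forall w, w \in u -> forall w', w' \in u ->
      w <> w' -> f w i <> f w' i) ->
      forall w, w \in u -> (t w -> rg_edge z (f w i)) /\ (~ t w -> ~ rg_edge z (f w i)).
    move=> i; have [inj|ninj] := pselect (forall w, w \in u -> forall w', w' \in u ->
      w <> w' -> f w i <> f w' i); last by exists 0%N.
    have [|z [zx zy]] := @rg_edge_ext [seq f w i | w <- u & `[< t w >]]
        [seq f w i | w <- u & ~~ `[< t w >]].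
      move=> _ /mapP[w + ->]; rewrite mem_filter => /andP[/asboolP tw wu].
      apply/negP => /mapP[w']; rewrite mem_filter => /andP[/asboolP tw' wu'].
      by apply: inj => // ww'; apply: tw'; rewrite -ww'.
    exists z => _ w wu; split=> tw.
      by apply: zx; apply: map_f; rewrite mem_filter wu andbT; exact/asboolP.
    by apply: (proj2 (zy _ _)); apply: map_f; rewrite mem_filter wu andbT; exact/asboolP.
  exists (upi D (z : I -> random_graph)) => p Hp.
  have [TW [c [cW ->]]] := WP p (HG _ Hp); set w := W p in TW cW *.
  have wu : w \in u by have : (W @` H) w; [by exists p|rewrite uE].
  have zE : D [set i | z i = urepr (upi D (z : I -> random_graph)) i].
    exact: (urepr_upi FD (z : I -> random_graph)).
  have inj : D [set i | forall w, w \in u -> forall w', w' \in u -> w <> w' -> f w i <> f w' i].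
    apply: (filter_forall_seq FD) => v vu; apply: (filter_forall_seq FD) => v' vu'.
    have [->|vv'] := eqVneq v v'; first by apply: (@filterS _ D FD _ _ _ filterT).
    by apply: (@filterS _ D FD _ _ _ (f_neq (uT _ vu) (uT _ vu') (elimN eqP vv'))).
  have good := @filterI _ D FD _ _ zE (@filterI _ D FD _ _ (aE w) inj).
  rewrite /lit; case: pselect => tw.
    apply/sat_atom; rewrite cW; apply: (@filterS _ D FD _ _ _ good) => i [/= <- [<- /(zP i) Z]].
    exact: (proj1 (Z w wu)).
  move=> /sat_atom; rewrite cW => /(filterI good)/filter_ex[i [[/= <- [<- /(zP i) Z]]]].
  exact: (proj2 (Z w wu)).
have [x xG] := satN A AK G typeG.
exists (urepr x) => w Tw.
pose c : {a : N | A a} := exist _ (a w) (ex_intro2 _ _ w Tw erefl).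
have := xG (lit w c); rewrite /lit; case: pselect => tw xw; split=> //.
- have /sat_atom xc : @sat _ (with_params A) (fun=> x) (atom c).
    by apply: xw; exists w; split=> //; exists c; split=> //; rewrite /lit; case: pselect.
  by move=> _; apply: filterS (filterI xc (aE w)) => i [] /= + ->.
- have nxc : ~ @sat _ (with_params A) (fun=> x) (atom c).
    by apply: xw; exists w; split=> //; exists c; split=> //; rewrite /lit; case: pselect.
  move=> _; have [xc|xc] := in_ultra_setVsetC [set i | rg_edge (urepr x i) (urepr (a w) i)] UD.
    by case: nxc; apply/sat_atom.
  by apply: filterS (filterI xc (aE w)) => i [] /= + ->.
Qed.

End Saturation.

(** * The ultrafilter *)

Lemma iterated_ultrafilter (T : eqType) (lt : T -> T -> Prop) (L : set T) :
  strict_well_order lt -> (forall u v, L u -> lt v u -> L v) ->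
  exists V : set_system (T -> nat), [/\ boolean_set_system V,
    forall a n, L a -> V [set y | (n < y a)%N],
    forall a b, lt a b -> L b -> V [set y | y a <> y b],
    forall S x (Q : nat -> set (T -> nat)), L x -> (forall n, supported S (Q n)) ->
      (forall w, S w -> L w -> lt w x) -> (forall n, V (Q n)) -> V [set y | Q (y x) y] &
    forall S S' A A' a b, lt a b -> L b -> supported S A -> supported S' A' ->
      ~ S b -> (forall w, S' w -> lt w b -> lt w a) ->
      V A -> V A' -> exists y, [/\ A y, A' y & y a = y b]].
Proof.
move=> ltP Ll.
have [E Eb E_gt] := nonprincipal_ultrafilter.
have [U UP] := tail_ultrafilters ltP.
exists (Iter ltP E U L); split.
- exact: boolean_Iter.
- by move=> a n La; apply/(Iter_coord ltP Eb UP [set m | (n < m)%N] La Ll).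
- by move=> a b ab Lb; exact: Iter_distinct.
- by move=> S x Q Lx SQ Sx QV; exact: (Iter_diagonal Eb UP Ll Lx SQ Sx QV).
- move=> S S' A A' a b ab Lb SA SA' Sb S'b; exact: (Iter_amalgam Eb UP ab Lb SA SA' Sb S'b).
Qed.

(** * Transfer along the Boolean homomorphism *)

Section Pullback.
Variables (I : Type) (T : eqType) (f : T -> I -> nat) (Phi : set I -> set (T -> nat)).
Hypothesis PhiI : forall A B, Phi (A `&` B) = Phi A `&` Phi B.
Hypothesis PhiC : forall A, Phi (~` A) = ~` Phi A.
Hypothesis Phif : forall w n, Phi [set i | f w i = n] = [set y | y w = n].

Lemma PhiS A B : A `<=` B -> Phi A `<=` Phi B.
Proof. by move=> /setIidl AB y; rewrite -{1}AB PhiI => -[]. Qed.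

Lemma Phi0 : Phi set0 = set0.
Proof. by rewrite -(setICl setT) PhiI PhiC setICl. Qed.

(** [Phi] need not commute with infinite unions over values, so one argues at a single [y], whose
    values at [a] and [b] select two cylinders; complements give the converse. *)
Lemma Phi_coord2 (R : nat -> nat -> Prop) a b :
  Phi [set i | R (f a i) (f b i)] = [set y | R (y a) (y b)].
Proof.
have PhiR (R' : nat -> nat -> Prop) y : R' (y a) (y b) -> Phi [set i | R' (f a i) (f b i)] y.
  move=> Ryy; have : (Phi [set i | f a i = y a] `&` Phi [set i | f b i = y b]) y.
    by rewrite !Phif.
  by rewrite -PhiI; apply: PhiS => i [/= -> ->].
apply/seteqP; split=> y; last exact: PhiR.
move=> PRy; apply: contrapT => /(PhiR (fun m n => ~ R m n)).
by rewrite -[X in Phi X]/(~` [set i | R (f a i) (f b i)]) PhiC.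
Qed.

Variable V : set_system (T -> nat).
Hypothesis Vb : boolean_set_system V.

Definition pullback : set_system I := [set A | V (Phi A)].

Lemma boolean_pullback : boolean_set_system pullback.
Proof.
by split=> [A B|A]; rewrite /pullback /= ?PhiI ?PhiC; [apply: (proj1 Vb)|apply: (proj2 Vb)].
Qed.

Variables (lt : T -> T -> Prop) (L : set T).

(** The sets where [g j] exceeds [n] have countable supports, $|J|$ many in all, whose points in [L]
    are bounded by some [x]; then [f x] lies below every [g j]. *)
Lemma pullback_lower_bound (J : Type) (g : J -> I -> nat) :
  (forall A, exists2 S, countable S & supported S (Phi A)) ->
  infinite_card J ->
  (forall Y : set T, Y `<=` L -> Y #<= [set: J] ->
     exists2 x, L x & forall y, Y y -> lt y x) ->
  (forall a n, L a -> V [set y | (n < y a)%N]) ->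
  (forall S x (Q : nat -> set (T -> nat)), L x -> (forall n, supported S (Q n)) ->
    (forall w, S w -> L w -> lt w x) -> (forall n, V (Q n)) -> V [set y | Q (y x) y]) ->
  (forall j, nonstandard pullback (g j)) ->
  exists2 h, nonstandard pullback h & forall j, pullback [set i | (h i < g j i)%N].
Proof.
move=> Phi_supp Jinf Lbd V_gt V_diag gns.
have /choice[S SP] : forall p : J * nat, exists S, countable S /\
    supported S (Phi [set i | (p.2 < g p.1 i)%N]).
  by move=> p; have [S cS sS] := Phi_supp [set i | (p.2 < g p.1 i)%N]; exists S.
have [||x Lx xub] := Lbd ((\bigcup_(p in [set: J * nat]) S p) `&` L).
- by move=> w [].
- apply: (card_le_trans (subset_card_le (@subIsetl _ _ _))).
  apply: bigcup_card_le => // [|p _]; last by apply: countable_card_le => //; have [] := SP p.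
  by apply: prod_card_le => //; exact/infiniteP.
exists (f x) => [n|j]; rewrite /pullback /=.
  by rewrite (Phi_coord2 (fun m _ => (n < m)%N) x x); exact: V_gt.
pose Q n := Phi [set i | (n < g j i)%N].
have : V [set y | Q (y x) y].
  apply: (V_diag (\bigcup_n S (j, n))) => // [n|w [n _ Sw] Lw|n].
  - move=> y y' yy'; apply: (proj2 (SP (j, n))) => w Sw; apply: yy'; by exists n.
  - by apply: xub; split=> //; exists (j, n).
  - exact: gns.
apply: (booleanS Vb) => y /= Qy.
have : (Phi [set i | f x i = y x] `&` Q (y x)) y by rewrite Phif.
by rewrite -PhiI; apply: PhiS => i [/= ->].
Qed.

End Pullback.

Theorem corollary6p6 (I : Type) (I_infinite : infinite_card I)
    (I_ge_mu_pp : exists mu mu1 mu2 : Type,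
        [/\ infinite_card mu, is_succ_card mu mu1, is_succ_card mu1 mu2 &
            [set: mu2] #<= [set: I]]) :
  exists D : set_system I,
    [/\ UltraFilter D,
        regular_filter D,
        (exists kappa I1 : Type,
            [/\ is_lcf D kappa, is_succ_card I I1 &
                [set: I1] #<= [set: kappa]]) &
        ~ saturates D random_graph_theory].
Proof.
have [mu [mu1 [mu2 [mu_inf [[mu_mu1 nmu1] _] [[mu1_mu2 nmu2] _] mu2I]]]] := I_ge_mu_pp.
have nat_mu : [set: nat] #<= [set: mu] by exact/infiniteP.
have mu1_inf : infinite_card mu1 by apply/infiniteP; exact: card_le_trans mu_mu1.
have mu1I : [set: mu1] #<= [set: I] by exact: card_le_trans mu2I.
have nImu1 : ~ ([set: I] #<= [set: mu1]) by move=> le; apply: nmu2; exact: card_le_trans le.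
have nmu1_count : ~ countable [set: mu1].
  by move=> le; apply: nmu1; exact: card_le_trans nat_mu.
have nTI : ~ ([set: set I] #<= [set: I]) by exact: card_powerset_nle.
have nTmu1 : ~ ([set: set I] #<= [set: mu1]).
  by move=> le; apply: nTI; exact: card_le_trans mu1I.
have [f [X [X_fin f_indep]]] := independent_family I_infinite.
(* The filter generated by the sets [X i]; extending it secures regularity. *)
pose D0 : set_system I := [set A | exists2 L, finite_set L &
  forall t, (forall i, L i -> X i t) -> A t].
have FD0 : Filter D0.
  split.
  - by exists set0.
  - move=> A B [L finL LA] [L' finL' L'B]; exists (L `|` L'); first by rewrite finite_setU.
    by move=> t Lt; split; [apply: LA|apply: L'B] => i Li; apply: Lt; [left|right].
  - by move=> A B AB [L finL LA]; exists L => // t /LA/AB.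
have posD0 : positive f D0.
  move=> [u y] [L finL LA]; have [t [Xt ft]] := f_indep L u y finL.
  by apply: (LA t Xt).
have [D1 [FD1 D01 posD1 decD1]] := maximal_positive_filter FD0 posD0.
have [Phi [PhiI PhiC PhiD Phif Phi_supp]] := boolean_hom FD1 posD1 decD1.
(* The power set only supplies enough points: its well-order has initial segments of types
   $\lambda^+$ and $\mu^{++}$. *)
have [lt ltP] := exists_strict_well_order (set I).
pose Omega := small lt I; pose Theta := small lt mu1.
have Omega_lower u v : Omega u -> lt v u -> Omega v by exact: small_lower.
have ThetaOmega : Theta `<=` Omega by exact: small_mono.
have [V [Vb V_gt V_neq V_diag V_amalg]] := iterated_ultrafilter ltP Omega_lower.
pose D := pullback Phi V.
have Db : boolean_set_system D by exact: boolean_pullback.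
have UD : UltraFilter D by exact: boolean_ultra.
have succI : is_succ_card I (Omega : Type) by exact: small_succ_card.
exists D; split=> //.
- exists X; split=> // i; rewrite /D /pullback /= PhiD; first exact: booleanT.
  by apply: D01; exists [set i] => [|t]; [exact: finite_set1|exact].
- have lb (g : I -> I -> nat) := pullback_lower_bound PhiI PhiC Phif Vb Phi_supp
    I_infinite (small_bounded ltP I_infinite nTI) V_gt V_diag (g := g).
  have [x Ox _] := small_bounded ltP I_infinite nTI (Y := set0) (@sub0set _ _) (card_ge0 _ _).
  have fx : nonstandard D (f x).
    move=> n; rewrite /D /pullback /= (Phi_coord2 PhiI PhiC Phif (fun m _ => (n < m)%N) x x).
    exact: V_gt.
  by have [kappa [lcf_kappa le]] := large_lcf _ succI fx lb; exists kappa, (Omega : Type).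
- move=> satD; have {satD} := satD random_graph models_random_graph _ succI.
  have f_neq w w' : Theta w -> Theta w' -> w <> w' -> D [set i | f w i <> f w' i].
    move=> /ThetaOmega Ow /ThetaOmega Ow' ww'; rewrite /D /pullback /=.
    rewrite (Phi_coord2 PhiI PhiC Phif (fun m n => m <> n) w w').
    have [lt_w|//|lt_w] := swo_total ltP w w'; first exact: V_neq.
    by apply: (booleanS Vb) (V_neq _ _ lt_w Ow) => y /= + /esym.
  have ThetaK : card_lt Theta [set: Omega].
    have ThetaI : Theta #<= [set: I] by exact: small_card_le.
    case: succI => [[I_K nKI] _]; split; first exact: card_le_trans I_K.
    by move=> le; apply: nKI; exact: card_le_trans ThetaI.
  move=> /(saturated_random_graph (uncountable_cofinality lt) UD ThetaK f_neq)[x xP].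
  (* The set attached to [w] consists of the indices where the realization treats [f w] as
     prescribed. *)
  have /choice[S SP] : forall w, exists S, countable S /\
      supported S (Phi [set i | uncountable_cofinality lt w <-> rg_edge (x i) (f w i)]).
    by move=> w; have [S ? ?] := Phi_supp [set i |
      uncountable_cofinality lt w <-> rg_edge (x i) (f w i)]; exists S.
  have [a [b [ab Tb na tb [nSab Sb]]]] := free_pair ltP mu1_inf nTmu1 nmu1_count
    (fun w => proj1 (SP w)).
  have Ta : Theta a by exact: small_lower ab.
  have DA : D [set i | uncountable_cofinality lt a <-> rg_edge (x i) (f a i)].
    by apply: (booleanS Db) (proj2 (xP a Ta) na) => i /= nR; split.
  have DB : D [set i | uncountable_cofinality lt b <-> rg_edge (x i) (f b i)].
    by apply: (booleanS Db) (proj1 (xP b Tb) tb) => i /= R; split.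
  have [y [Ay By yab]] := V_amalg _ _ _ _ _ _ ab (ThetaOmega _ Tb)
    (proj2 (SP a)) (proj2 (SP b)) nSab Sb DA DB.
  have Cy : Phi [set i | f a i = f b i] y.
    by rewrite (Phi_coord2 PhiI PhiC Phif (fun m n => m = n) a b).
  have : (Phi [set i | uncountable_cofinality lt a <-> rg_edge (x i) (f a i)] `&`
      (Phi [set i | uncountable_cofinality lt b <-> rg_edge (x i) (f b i)] `&`
       Phi [set i | f a i = f b i])) y by [].
  (* Where [f a] and [f b] coincide, the realization would be both joined and not joined to one
     vertex. *)
  rewrite -!PhiI (_ : _ `&` _ = set0) ?(Phi0 PhiI PhiC) // -subset0.
  move=> i [/= aR [bR fab]]; apply: na; apply/aR; rewrite fab; exact/bR.
Qed.
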